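(* One can assign to every tuple $(A,B,C,f,H)$, consisting of pointed path-connected CW-complexes $A,B,C$, a map $f:A\to C$, and a homotopy $H:A\times I\to C$ from $f=H|_{A\times\{0\}}$ to the constant map $H|_{A\times\{1\}}$ at the basepoint, a homotopy equivalence \[e_{(A,B,C,f,H)}:(A*B)\vee (C\rtimes B)\xrightarrow{\ \simeq\ } Q,\] where $Q$ is the homotopy pushout of $A\xleftarrow{\pi_1}A\times B\xrightarrow{f\times \mathrm{id}_B}C\times B$, which is natural in the following sense. Let $(A,B,C,f,H)$ and $(A',B',C',f',H')$ be two such tuples with homotopy pushouts $Q$ and $Q'$, and let $a:A\to A'$, $b:B\to B'$, $c:C\to C'$ be continuous maps such that the square \[c\circ H=H'\circ(a\times \mathrm{id}_I):A\times I\to C'\] strictly commutes. Let $q:Q\to Q'$ be the map of homotopy pushouts induced by $a\times b:A\times B\to A'\times B'$, $c\times b:C\times B\to C'\times B'$ and $a:A\to A'$. Then \[q\circ e_{(A,B,C,f,H)}\simeq e_{(A',B',C',f',H')}\circ\big((a*b)\vee(c\rtimes b)\big).\]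
   Context: $I=[0,1]$, and $\pi_1$ is projection onto the first factor. Spaces are path-connected pointed CW-complexes and maps are pointed. The right half-smash is $X\rtimes Y=X\times Y/( *\times Y)$. The reduced join is $X*Y=(X\times I\times Y)/\sim$ with $(x,0,y)\sim(x,0,y')$, $(x,1,y)\sim(x',1,y)$ and $(x_0,t,y_0)\sim(x_0,0,y_0)$, where $x_0,y_0$ are the basepoints; up to homotopy equivalence it is $X\times CY\cup_{X\times Y}CX\times Y$, where $C(-)$ in this formula denotes the cone. The maps $a*b$ and $c\rtimes b$ are the evident induced maps. *)

(* Defs.v *)
From HB Require Import structures.
From Stdlib Require Import Relation_Operators.
From mathcomp Require Import all_boot all_order all_algebra.
From mathcomp Require Import generic_quotient.
From mathcomp Require Import all_classical all_reals all_analysis homotopy.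

Set Implicit Arguments.
Unset Strict Implicit.
Unset Printing Implicit Defensive.

Import Order.TTheory GRing.Theory Num.Theory.
Import numFieldNormedType.Exports.
Local Open Scope classical_set_scope.
Local Open Scope ring_scope.
Local Open Scope quotient_scope.

Definition unit_itv (R : realType) : Type := set_type (`[0, 1]%classic : set R).

Section interval_endpoints.
Variable R : realType.

Let zero_in : (0 : R) \in (`[0, 1]%classic : set R).
Proof. by apply/mem_set; rewrite /= in_itv /= lexx ler01. Qed.

Let one_in : (1 : R) \in (`[0, 1]%classic : set R).
Proof. by apply/mem_set; rewrite /= in_itv /= lexx ler01. Qed.

Definition itv0 : unit_itv R := exist _ 0 zero_in.
Definition itv1 : unit_itv R := exist _ 1 one_in.

HB.instance Definition _ :=
  Topological.copy (unit_itv R) (set_type (`[0, 1]%classic : set R)).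

Let itv0_neq_itv1 : itv0 != itv1.
Proof. by apply/eqP => /(congr1 val) /= /eqP; rewrite eq_sym oner_eq0. Qed.

HB.instance Definition _ := isBiPointed.Build (unit_itv R) itv0_neq_itv1.
HB.instance Definition _ := isPointed.Build (unit_itv R) itv0.

End interval_endpoints.

Arguments itv0 {R}.
Arguments itv1 {R}.

HB.instance Definition _ (X Y : ptopologicalType) :=
  Topological.on (X * Y)%type.

Section sum_topology.
Variables X Y : topologicalType.

Definition sum_open : set_system (X + Y)%type :=
  fun U => open (inl @^-1` U) /\ open (inr @^-1` U).

Let sum_openT : sum_open setT.
Proof. by split; rewrite preimage_setT; exact: openT. Qed.

Let sum_openI (U V : set (X + Y)) :
  sum_open U -> sum_open V -> sum_open (U `&` V).
Proof. by move=> [? ?] [? ?]; split; exact: openI. Qed.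

Let sum_open_bigcup (J : Type) (U : J -> set (X + Y)) :
  (forall j, sum_open (U j)) -> sum_open (\bigcup_j U j).
Proof.
by move=> oU; split; apply: bigcup_open => j _; have [] := oU j.
Qed.

HB.instance Definition _ := isOpenTopological.Build (X + Y)%type
  sum_openT sum_openI sum_open_bigcup.

End sum_topology.

Section generated_quotient.
Variables (X : topologicalType) (e : X -> X -> Prop).

Definition generated_rel : rel X :=
  fun x y => `[< clos_refl_sym_trans X e x y >].

Let generated_refl : reflexive generated_rel.
Proof. by move=> x; apply/asboolP; exact: rst_refl. Qed.

Let generated_sym : symmetric generated_rel.
Proof. by move=> x y; apply/asboolP/asboolP; exact: rst_sym. Qed.

Let generated_trans : transitive generated_rel.
Proof.
by move=> y x z /asboolP xy /asboolP yz; apply/asboolP; exact: rst_trans xy yz.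
Qed.

Definition generated_equiv : equiv_rel X :=
  EquivRel _ generated_refl generated_sym generated_trans.

Definition quot := {eq_quot generated_equiv}.

HB.instance Definition _ := Topological.copy quot (quotient_topology quot).
HB.instance Definition _ := Quotient.on quot.

Definition quot_pi (x : X) : quot := \pi_quot x.

Lemma quot_piP x y : quot_pi x = quot_pi y <-> clos_refl_sym_trans X e x y.
Proof.
split=> [/eqmodP|xy]; first by move/asboolP.
by apply/eqmodP/asboolP.
Qed.

End generated_quotient.

(* Induced map; it is only meaningful when [g] maps related points to related
   points, cf. [quot_mapE]. *)
Definition quot_map (X X' : topologicalType) (e : X -> X -> Prop)
    (e' : X' -> X' -> Prop) (g : X -> X') : quot e -> quot e' :=
  fun z => quot_pi e' (g (repr z)).

Arguments quot_map {X X' e e'} g.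

Lemma quot_mapE (X X' : topologicalType) (e : X -> X -> Prop)
    (e' : X' -> X' -> Prop) (g : X -> X') :
  (forall x y, e x y -> clos_refl_sym_trans X' e' (g x) (g y)) ->
  forall x, quot_map (e := e) (e' := e') g (quot_pi e x) = quot_pi e' (g x).
Proof.
move=> eg x; apply/quot_piP.
have /quot_piP : quot_pi e (repr (quot_pi e x)) = quot_pi e x by exact: reprK.
move: (repr _) => z; elim=> {x z} [x y /eg//|x|x y _|x y z _ + _].
- by exact: rst_refl.
- by exact: rst_sym.
- by exact: rst_trans.
Qed.

Definition pointed_map (X Y : ptopologicalType) (f : X -> Y) : Prop :=
  continuous f /\ f point = point.

Definition pointed_homotopic (R : realType) (X Y : ptopologicalType)
    (f g : X -> Y) : Prop :=
  exists K : X * unit_itv R -> Y,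
    [/\ continuous K,
        forall x, K (x, itv0) = f x,
        forall x, K (x, itv1) = g x &
        forall t, K (point, t) = point].

Definition pointed_homotopy_equivalence (R : realType)
    (X Y : ptopologicalType) (f : X -> Y) : Prop :=
  pointed_map f /\
  exists g : Y -> X,
    [/\ pointed_map g,
        pointed_homotopic R (g \o f) idfun &
        pointed_homotopic R (f \o g) idfun].

Definition path_connected (R : realType) (X : topologicalType) : Prop :=
  forall x y : X, inhabited {path (unit_itv R) from x to y}.

Section discs.
Variables (R : realType) (n : nat).

Definition sqnorm (v : 'rV[R]_n) : R := \sum_(i < n) v ord0 i ^+ 2.
Definition disc : set 'rV[R]_n := [set v | sqnorm v <= 1].
Definition open_disc : set 'rV[R]_n := [set v | sqnorm v < 1].
Definition sphere : set 'rV[R]_n := [set v | sqnorm v = 1].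

End discs.

Arguments disc : clear implicits.
Arguments open_disc : clear implicits.
Arguments sphere : clear implicits.

(* Whitehead's definition. A characteristic map is represented by a function on
   the whole of R^n, of which only the restriction to the closed disc matters. *)
Record cw_structure (R : realType) (X : topologicalType) := CWStructure {
  cell : Type;
  dim : cell -> nat;
  char_map : forall c, 'rV[R]_(dim c) -> X;
  open_cell := fun c => @char_map c @` open_disc R (dim c);
  char_map_continuous : forall c,
    {within disc R (dim c), continuous (@char_map c)};
  char_map_inj : forall c,
    {in open_disc R (dim c) &, injective (@char_map c)};
  open_cells_disjoint : trivIset setT open_cell;
  open_cells_cover : \bigcup_c open_cell c = setT;
  closure_finite : forall c, exists s : set cell,
    [/\ finite_set s,
        forall d, s d -> (dim d < dim c)%N &
        @char_map c @` sphere R (dim c)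
          `<=` \bigcup_(d in s) open_cell d];
  weak_topology : forall F : set X,
    closed F <->
    forall c, closed (disc R (dim c) `&` @char_map c @^-1` F)
}.

Definition cw_complex (R : realType) (X : topologicalType) : Prop :=
  hausdorff_space X /\ inhabited (cw_structure R X).

(* The basepoint need not be a 0-cell. *)
Record pcCW (R : realType) := PCCW {
  pcCW_space :> ptopologicalType;
  pcCW_cw : cw_complex R pcCW_space;
  pcCW_path_connected : path_connected R pcCW_space
}.

Section half_smash.

Definition half_smash_rel (X Y : ptopologicalType) (p q : X * Y) : Prop :=
  p.1 = point /\ q.1 = point.

Definition half_smash (X Y : ptopologicalType) :=
  quot (@half_smash_rel X Y).

HB.instance Definition _ (X Y : ptopologicalType) :=
  Topological.on (half_smash X Y).
HB.instance Definition _ (X Y : ptopologicalType) :=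
  isPointed.Build (half_smash X Y)
    (quot_pi (@half_smash_rel X Y) (point, point)).

Definition half_smash_map (X Y X' Y' : ptopologicalType)
    (c : X -> X') (b : Y -> Y') : half_smash X Y -> half_smash X' Y' :=
  quot_map (fun p => (c p.1, b p.2)).

Lemma half_smash_mapE (X Y X' Y' : ptopologicalType)
    (c : X -> X') (b : Y -> Y') :
  c point = point ->
  forall x y, half_smash_map c b (quot_pi _ (x, y)) = quot_pi _ (c x, b y).
Proof.
move=> c0 x y; rewrite /half_smash_map quot_mapE// => {x y} -[x y] [x' y'].
by move=> [/= -> ->]; apply: rst_step; split.
Qed.

End half_smash.

Section reduced_join.
Variable R : realType.

Inductive join_rel (X Y : ptopologicalType) :
    X * unit_itv R * Y -> X * unit_itv R * Y -> Prop :=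
| join_rel0 x y y' : join_rel (x, itv0, y) (x, itv0, y')
| join_rel1 x x' y : join_rel (x, itv1, y) (x', itv1, y)
| join_rel_point t : join_rel (point, t, point) (point, itv0, point).

Definition reduced_join (X Y : ptopologicalType) := quot (@join_rel X Y).

HB.instance Definition _ (X Y : ptopologicalType) :=
  Topological.on (reduced_join X Y).
HB.instance Definition _ (X Y : ptopologicalType) :=
  isPointed.Build (reduced_join X Y)
    (quot_pi (@join_rel X Y) (point, itv0, point)).

Definition join_map (X Y X' Y' : ptopologicalType)
    (a : X -> X') (b : Y -> Y') : reduced_join X Y -> reduced_join X' Y' :=
  quot_map (fun p => (a p.1.1, p.1.2, b p.2)).

Lemma join_mapE (X Y X' Y' : ptopologicalType)
    (a : X -> X') (b : Y -> Y') :
  a point = point -> b point = point ->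
  forall x t y,
    join_map a b (quot_pi _ (x, t, y)) = quot_pi _ (a x, t, b y).
Proof.
move=> a0 b0 x t y; rewrite /join_map quot_mapE// => {x t y} p q.
case=> [x y y'|x x' y|t] /=; rewrite ?a0 ?b0; apply: rst_step.
- exact: join_rel0.
- exact: join_rel1.
- exact: join_rel_point.
Qed.

End reduced_join.

Section binary_wedge.

Definition wedge_summand (X Y : ptopologicalType) (i : bool) :
  ptopologicalType := if i then X else Y.

Definition pwedge2 (X Y : ptopologicalType) := pwedge (wedge_summand X Y).

HB.instance Definition _ (X Y : ptopologicalType) :=
  PointedTopological.on (pwedge2 X Y).

Definition pwedge2_lift (X Y : ptopologicalType) (i : bool) :
    wedge_summand X Y i -> pwedge2 X Y :=
  @wedge_lift bool (wedge_summand X Y) (fun=> point) i.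

Lemma pwedge2_lift_point (X Y : ptopologicalType) :
  @pwedge2_lift X Y true point = @pwedge2_lift X Y false point.
Proof.
exact: (@wedge_liftE bool (wedge_summand X Y) (fun=> point)
  false point true point).
Qed.

Definition pwedge2_map (X Y X' Y' : ptopologicalType)
    (g : X -> X') (h : Y -> Y') : pwedge2 X Y -> pwedge2 X' Y' :=
  wedge_fun (fun i : bool =>
    match i return wedge_summand X Y i -> pwedge2 X' Y' with
    | true => fun x => @pwedge2_lift X' Y' true (g x)
    | false => fun y => @pwedge2_lift X' Y' false (h y)
    end).

Lemma pwedge2_mapE (X Y X' Y' : ptopologicalType)
    (g : X -> X') (h : Y -> Y') :
  g point = point -> h point = point ->
  (forall x : X, pwedge2_map g h (@pwedge2_lift X Y true x) =
                 @pwedge2_lift X' Y' true (g x)) /\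
  (forall y : Y, pwedge2_map g h (@pwedge2_lift X Y false y) =
                 @pwedge2_lift X' Y' false (h y)).
Proof.
move=> g0 h0.
pose lifts i : wedge_summand X Y i -> pwedge2 X' Y' :=
  match i return wedge_summand X Y i -> pwedge2 X' Y' with
  | true => fun x => @pwedge2_lift X' Y' true (g x)
  | false => fun y => @pwedge2_lift X' Y' false (h y)
  end.
have liftsE i j : lifts i point = lifts j point.
  by case: i; case: j; rewrite /= ?g0 ?h0 // pwedge2_lift_point.
split=> z; first exact: (@wedge_lift_funE _ _ _ _ lifts true z liftsE).
exact: (@wedge_lift_funE _ _ _ _ lifts false z liftsE).
Qed.

End binary_wedge.

Section homotopy_pushout.
Variable R : realType.

(* The double mapping cylinder of a diagram [Y <-g- X -h-> Z] of pointed
   spaces, reduced as the join is: the segment over the basepoint is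
   collapsed. *)
Inductive hpushout_rel (X Y Z : ptopologicalType) (g : X -> Y) (h : X -> Z) :
    Y + X * unit_itv R + Z -> Y + X * unit_itv R + Z -> Prop :=
| hpushout_rel0 x : hpushout_rel g h (inl (inr (x, itv0))) (inl (inl (g x)))
| hpushout_rel1 x : hpushout_rel g h (inl (inr (x, itv1))) (inr (h x))
| hpushout_rel_point t :
    hpushout_rel g h (inl (inr (point, t))) (inl (inr (point, itv0))).

Definition hpushout (X Y Z : ptopologicalType) (g : X -> Y) (h : X -> Z) :=
  quot (hpushout_rel g h).

HB.instance Definition _ (X Y Z : ptopologicalType)
    (g : X -> Y) (h : X -> Z) := Topological.on (hpushout g h).
HB.instance Definition _ (X Y Z : ptopologicalType)
    (g : X -> Y) (h : X -> Z) :=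
  isPointed.Build (hpushout g h)
    (quot_pi (hpushout_rel g h) (inl (inl point))).

Definition cylinder_map (X Y Z X' Y' Z' : ptopologicalType)
    (u : X -> X') (v : Y -> Y') (w : Z -> Z') :
    Y + X * unit_itv R + Z -> Y' + X' * unit_itv R + Z' :=
  fun p => match p with
  | inl (inl y) => inl (inl (v y))
  | inl (inr (x, t)) => inl (inr (u x, t))
  | inr z => inr (w z)
  end.

Definition hpushout_map (X Y Z X' Y' Z' : ptopologicalType)
    (g : X -> Y) (h : X -> Z) (g' : X' -> Y') (h' : X' -> Z')
    (u : X -> X') (v : Y -> Y') (w : Z -> Z') :
    hpushout g h -> hpushout g' h' :=
  quot_map (cylinder_map u v w).

Arguments hpushout_map {X Y Z X' Y' Z' g h g' h'} u v w.

Lemma hpushout_mapE (X Y Z X' Y' Z' : ptopologicalType)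
    (g : X -> Y) (h : X -> Z) (g' : X' -> Y') (h' : X' -> Z')
    (u : X -> X') (v : Y -> Y') (w : Z -> Z') :
  u point = point -> v \o g = g' \o u -> w \o h = h' \o u ->
  forall p, hpushout_map (g := g) (h := h) (g' := g') (h' := h') u v w
              (quot_pi _ p) = quot_pi _ (cylinder_map u v w p).
Proof.
move=> u0 vg wh p; rewrite /hpushout_map quot_mapE// => {p} p q.
case=> [x|x|t] /=; apply: rst_step.
- by rewrite -[v (g x)]/((v \o g) x) vg; exact: hpushout_rel0.
- by rewrite -[w (h x)]/((w \o h) x) wh; exact: hpushout_rel1.
- by rewrite u0; exact: hpushout_rel_point.
Qed.

End homotopy_pushout.

Arguments hpushout_map {R X Y Z X' Y' Z' g h g' h'} u v w.

(* The homotopy [H] is not required to preserve the basepoint. *)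
Record null_tuple (R : realType) := NullTuple {
  tA : pcCW R;
  tB : pcCW R;
  tC : pcCW R;
  tf : tA -> tC;
  tH : tA * unit_itv R -> tC;
  tf_pointed : pointed_map tf;
  tH_continuous : continuous tH;
  tH0 : forall x, tH (x, itv0) = tf x;
  tH1 : forall x, tH (x, itv1) = point
}.

Definition tuple_wedge (R : realType) (T : null_tuple R) : ptopologicalType :=
  pwedge2 (reduced_join R (tA T) (tB T)) (half_smash (tC T) (tB T)).

Definition tuple_pushout (R : realType) (T : null_tuple R) : ptopologicalType :=
  @hpushout R (tA T * tB T)%type (tA T) (tC T * tB T)%type
    fst (fun p => (tf p.1, p.2)).

Definition tuple_wedge_map (R : realType) (T T' : null_tuple R)
    (a : tA T -> tA T') (b : tB T -> tB T') (c : tC T -> tC T') :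
    tuple_wedge T -> tuple_wedge T' :=
  pwedge2_map (join_map a b) (half_smash_map c b).

Definition tuple_pushout_map (R : realType) (T T' : null_tuple R)
    (a : tA T -> tA T') (b : tB T -> tB T') (c : tC T -> tC T') :
    tuple_pushout T -> tuple_pushout T' :=
  hpushout_map (fun p => (a p.1, b p.2)) a (fun p => (c p.1, b p.2)).

(* Main.v *)
(* There is a zigzag of pointed homotopy equivalences, each of them strictly
   natural with respect to the maps of tuples,

     (A * B) v (C >< B) <- (A *' B) v (C x B u Cone(B)) -> Q_0 -> Q' -> Q,

   in which [A *' B] and [Q'] are the unreduced join and double mapping cylinder
   (the segment over the basepoint is not collapsed), [Cone(B)] is attached along
   [{point} x B], and [Q_0] is [Q'] with [f] replaced by the constant map. Then
   [e] is obtained by inverting the first map up to homotopy, and its naturality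
   up to homotopy is automatic.
   The second map contracts the end [B] of the join in [Q_0], and the third one
   appends [H] to the cylinder: since the segment over the basepoint is still
   there, [H] need not preserve the basepoint. The outer maps collapse
   contractible subspaces; they are equivalences because every point of a CW
   complex is nondegenerate, by induction over the cells. *)

Require Import Defs.
From HB Require Import structures.
From Stdlib Require Import Relation_Operators.
From mathcomp Require Import all_boot all_order all_algebra.
From mathcomp Require Import generic_quotient.
From mathcomp Require Import all_classical all_reals all_analysis homotopy.
From mathcomp Require Import lra.

Set Implicit Arguments.
Unset Strict Implicit.
Unset Printing Implicit Defensive.

Import Order.TTheory GRing.Theory Num.Theory.
Import numFieldNormedType.Exports.
Local Open Scope classical_set_scope.
Local Open Scope ring_scope.

(** * Gluing and quotients *)

(** Two obstacles shape the development. A product of CW complexes, with the product topology, need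
    not be a CW complex. So cells serve only to show that basepoints are nondegenerate; from there
    on the argument rests on [well_pointed], a condition stable under products. Likewise, the
    product of a quotient map with a space that is not locally compact need not be a quotient map.
    So the quotients are multiplied with nothing but the interval, whose compactness keeps them
    quotients; a factor [B] always enters before the quotient is taken. The equivalences are proved
    by explicit formulas, piecewise affine in time. Most constants are the breakpoints of such
    formulas: a path made of k unit pieces is run at speed k, and two paths that differ by running
    forth and back are joined by interpolating their parameters on a longer path. *)

Definition cts (T U : topologicalType) (f : T -> U) : Prop := continuous f.

Lemma cts_ext (T U : topologicalType) (f g : T -> U) :
  f =1 g -> cts g -> cts f.
Proof. by move=> /funext ->. Qed.

(** Both branches of a piecewise formula are defined everywhere, so that continuity of the whole
    ([cts_ifle]) only asks that they agree where [a = b]. *)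
Definition ifle (R : realType) (T : Type) (a b : R) (x y : T) : T :=
  if a <= b then x else y.

Lemma ifleT (R : realType) (T : Type) (a b : R) (x y : T) :
  a <= b -> ifle a b x y = x.
Proof. by rewrite /ifle => ->. Qed.

Lemma ifleF (R : realType) (T : Type) (a b : R) (x y : T) :
  b < a -> ifle a b x y = y.
Proof. by rewrite /ifle leNgt => ->. Qed.

Lemma ifle_ge (R : realType) (T : Type) (a b : R) (x y : T) :
  (a = b -> x = y) -> b <= a -> ifle a b x y = y.
Proof.
move=> xy ba; rewrite /ifle; case: ifPn => // ab; apply: xy; apply/eqP.
by rewrite eq_le ab.
Qed.

Section continuity.
Variables (R : realType) (T : topologicalType).

Lemma cts_id : cts (fun x : T => x).
Proof. by move=> x; exact: cvg_id. Qed.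

Lemma cts_cst (U : topologicalType) (u : U) : cts (fun _ : T => u).
Proof. by move=> x; exact: cvg_cst. Qed.

Lemma cts_comp (U V : topologicalType) (g : U -> V) (f : T -> U) :
  cts g -> cts f -> cts (fun x => g (f x)).
Proof.
by move=> cg cf x; apply: (@continuous_comp _ _ _ f g); [exact: cf|exact: cg].
Qed.

Lemma cts_pair (U V : topologicalType) (f : T -> U) (g : T -> V) :
  cts f -> cts g -> cts (fun x => (f x, g x)).
Proof. by move=> cf cg x; apply: cvg_pair; [exact: cf|exact: cg]. Qed.

Lemma cts_fst (U V : topologicalType) (f : T -> U * V) :
  cts f -> cts (fun x => (f x).1).
Proof. by move=> cf; apply: cts_comp cf => x; exact: cvg_fst. Qed.

Lemma cts_snd (U V : topologicalType) (f : T -> U * V) :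
  cts f -> cts (fun x => (f x).2).
Proof. by move=> cf; apply: cts_comp cf => x; exact: cvg_snd. Qed.

Lemma cts_add (f g : T -> R) : cts f -> cts g -> cts (fun x => f x + g x).
Proof. by move=> cf cg x; apply: cvgD; [exact: cf|exact: cg]. Qed.

Lemma cts_opp (f : T -> R) : cts f -> cts (fun x => - f x).
Proof. by move=> cf x; apply: cvgN; exact: cf. Qed.

Lemma cts_mul (f g : T -> R) : cts f -> cts g -> cts (fun x => f x * g x).
Proof. by move=> cf cg x; apply: cvgM; [exact: cf|exact: cg]. Qed.

Lemma cts_max (f g : T -> R) :
  cts f -> cts g -> cts (fun x => Num.max (f x) (g x)).
Proof. by move=> cf cg x; apply: continuous_max; [exact: cf|exact: cg]. Qed.

Lemma cts_min (f g : T -> R) :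
  cts f -> cts g -> cts (fun x => Num.min (f x) (g x)).
Proof. by move=> cf cg x; apply: continuous_min; [exact: cf|exact: cg]. Qed.

Lemma cts_glue (U : topologicalType) (A B : set T) (f g h : T -> U) :
  closed A -> closed B -> (forall x, A x \/ B x) -> cts f -> cts g ->
  (forall x, A x -> h x = f x) -> (forall x, B x -> h x = g x) -> cts h.
Proof.
move=> cA cB AB cf cg hf hg; apply/continuous_closedP => E cE.
rewrite (_ : _ @^-1` _ = (A `&` f @^-1` E) `|` (B `&` g @^-1` E)).
  by apply: closedU; apply: closedI => //;
    [move/continuous_closedP: cf; exact|move/continuous_closedP: cg; exact].
apply/seteqP; split=> x /=.
  by case: (AB x) => [Ax|Bx]; [rewrite hf//; left|rewrite hg//; right].
by case=> [[/hf <-]|[/hg <-]].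
Qed.

Lemma closed_le_fun (a b : T -> R) : cts a -> cts b -> closed [set x | a x <= b x].
Proof.
move=> ca cb; rewrite (_ : mkset _ = (fun x => a x - b x) @^-1` [set y | y <= 0]).
  have /continuous_closedP : cts (fun x => a x - b x).
    by apply: cts_add => //; exact: cts_opp.
  by apply; exact: closed_le.
by apply/seteqP; split => x /=; rewrite subr_le0.
Qed.

Lemma cts_ifle (U : topologicalType) (a b : T -> R) (f g : T -> U) :
  cts a -> cts b -> cts f -> cts g -> (forall x, a x = b x -> f x = g x) ->
  cts (fun x => ifle (a x) (b x) (f x) (g x)).
Proof.
move=> ca cb cf cg fg.
apply: (@cts_glue _ [set x | a x <= b x] [set x | b x <= a x] f g) => //.
- exact: closed_le_fun.
- exact: closed_le_fun.
- by move=> x /=; apply/orP; exact: le_total.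
- by move=> x /=; exact: ifleT.
move=> x /= ba; rewrite /ifle; case: ifPn => // ab; apply: fg; apply/eqP.
by rewrite eq_le ab.
Qed.

End continuity.

(** * The interval as a retract of the real line *)

Section unit_interval.
Variable R : realType.

Definition uval (t : unit_itv R) : R := set_val t.

Lemma uval_ge0 t : 0 <= uval t.
Proof.
by case: t => t ti; have := set_mem ti; rewrite /uval/= in_itv/= => /andP[].
Qed.

Lemma uval_le1 t : uval t <= 1.
Proof.
by case: t => t ti; have := set_mem ti; rewrite /uval/= in_itv/= => /andP[].
Qed.

Lemma uval_inj : injective uval.
Proof. by move=> s t st; apply: val_inj. Qed.

Lemma cts_uval (T : topologicalType) (f : T -> unit_itv R) :
  cts f -> cts (fun x => uval (f x)).
Proof. by apply: cts_comp; exact: initial_continuous. Qed.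

Let clamp_in (x : R) : Num.max 0 (Num.min 1 x) \in (`[0, 1]%classic : set R).
Proof.
by apply/mem_set; rewrite /= in_itv/= le_max lexx/= ge_max ler01/= ge_min lexx.
Qed.

(** The retraction of the line onto the interval. It makes every real formula a legitimate time or
    cylinder coordinate, and lets a motion wait at an end outside its own time span. *)
Definition clamp (x : R) : unit_itv R :=
  exist (fun y => y \in (`[0, 1]%classic : set R)) _ (clamp_in x).

Lemma uval_clamp x : uval (clamp x) = Num.max 0 (Num.min 1 x).
Proof. by []. Qed.

Lemma clampE x : 0 <= x <= 1 -> uval (clamp x) = x.
Proof.
by move=> /andP[x0 x1]; rewrite uval_clamp (min_idPr x1) (max_idPr x0).
Qed.

Lemma clampK t : clamp (uval t) = t.
Proof. by apply: uval_inj; rewrite clampE// uval_ge0 uval_le1. Qed.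

Lemma clamp_le0 x : x <= 0 -> clamp x = itv0.
Proof.
move=> x0; apply: uval_inj; rewrite uval_clamp (min_idPr _) ?(max_idPl _)//.
by rewrite (le_trans x0).
Qed.

Lemma clamp_ge1 x : 1 <= x -> clamp x = itv1.
Proof.
by move=> x1; apply: uval_inj; rewrite uval_clamp (min_idPl _)// (max_idPr _).
Qed.

Lemma clamp0 : clamp 0 = itv0. Proof. exact: clamp_le0. Qed.
Lemma clamp1 : clamp 1 = itv1. Proof. exact: clamp_ge1. Qed.
Lemma uval0 : uval itv0 = 0. Proof. by []. Qed.
Lemma uval1 : uval itv1 = 1. Proof. by []. Qed.

Lemma cts_clamp (T : topologicalType) (f : T -> R) :
  cts f -> cts (fun x => clamp (f x)).
Proof.
move=> cf; apply/continuous_comp_initial; apply: cts_max; first exact: cts_cst.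
by apply: cts_min => //; exact: cts_cst.
Qed.

Lemma itv_compact : compact [set: unit_itv R].
Proof.
rewrite (_ : [set: _] = clamp @` `[0, 1]%classic).
  apply: continuous_compact; last exact: segment_compact.
  exact/continuous_subspaceT/cts_clamp/cts_id.
apply/seteqP; split=> // t _; exists (uval t); last exact: clampK.
by rewrite /= in_itv/= uval_ge0 uval_le1.
Qed.

Lemma itv_regular : regular_space (unit_itv R).
Proof. exact: (@uniform_regular (set_type (`[0, 1]%classic : set R))). Qed.

End unit_interval.

(** * Final topologies and their product with the interval *)

Section final_topology.
Variables (J : Type) (P : J -> topologicalType) (X : topologicalType).
Variable q : forall j, P j -> X.

(** Disjoint unions, quotients, wedges and CW complexes with their characteristic maps are all of
    this form, so the product with the interval is treated once for all of them. *)
Definition final_family : Prop :=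
  (forall x, exists j (p : P j), q p = x) /\
  (forall U : set X, (forall j, open (@q j @^-1` U)) -> open U).

Hypothesis qfinal : final_family.

Lemma cts_final (Z : topologicalType) (g : X -> Z) :
  (forall j, cts (fun p : P j => g (q p))) -> cts g.
Proof.
move=> gq; apply/continuousP => V oV; apply: qfinal.2 => j.
by move/continuousP: (gq j) => /(_ V oV).
Qed.

(* The tube lemma makes [q x id] final as well, since the interval is compact. *)
Lemma cts_final_itv (R : realType) (Z : topologicalType)
    (g : X * unit_itv R -> Z) :
  (forall j, cts (fun p : P j * unit_itv R => g (q p.1, p.2))) -> cts g.
Proof.
move=> gq; apply/continuousP => V oV; rewrite openE => -[x0 t0] Vg.
have [j [p qp]] := qfinal.1 x0.
have cs : cts (fun t => g (x0, t)).
  rewrite -qp; apply: (cts_comp (f := fun t => (p, t)) (gq j)).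
  by apply: cts_pair; [exact: cts_cst|exact: cts_id].
(* Regularity of the interval provides a neighbourhood of [t0] whose closure, a compact set, is
   still sent into [V] over [x0]. *)
have /(itv_regular (a := t0))[N Nt0 NV] : nbhs t0 ((fun t => g (x0, t)) @^-1` V).
  by apply: open_nbhs_nbhs; split => //; move/continuousP: cs; exact.
have Kc : compact (closure N).
  apply: subclosed_compact (@itv_compact R) _ => //.
  exact: closed_closure.
pose U := [set x | forall t, closure N t -> V (g (x, t))].
(* Openness is tested on each [P i]; there, compactness of the closure of [N] gives a neighbourhood
   of [y] that works for all times at once. *)
have oU : open U.
  apply: qfinal.2 => i; rewrite openE => y Uy.
  have /compact_near_coveringP := Kc.
  move=> /(_ _ (nbhs y) (fun z t => V (g (q z, t)))) /=; apply => t Kt.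
  have /(_ (y, t)) := gq i.
  move=> /(_ V) /=.
  have Vn : nbhs (g (q y, t)) V by apply: open_nbhs_nbhs; split => //; exact: Uy.
  move=> /(_ Vn) [[A B] /= [Ay Bt] AB]; exists (B, A) => //= -[t' y'] /= [? ?].
  exact: (AB (y', t')).
exists (U, N) => /=; last by move=> [x t] /= [Ux Nt]; apply: Ux; exact: subset_closure.
split=> //; apply: open_nbhs_nbhs; split => // t Kt; exact: (NV t Kt).
Qed.

End final_topology.

Section glued_spaces.
Variable R : realType.

Lemma cts_inl (X Y : topologicalType) : cts (@inl X Y).
Proof. by apply/continuousP => U [oU _]. Qed.

Lemma cts_inr (X Y : topologicalType) : cts (@inr X Y).
Proof. by apply/continuousP => U [_ oU]. Qed.

Let sum_family (X Y : topologicalType) (b : bool) : topologicalType :=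
  if b then X else Y.

Let sum_incl (X Y : topologicalType) (b : bool) :
  sum_family X Y b -> (X + Y)%type :=
  match b return sum_family X Y b -> (X + Y)%type with
  | true => inl | false => inr end.

Let sum_final (X Y : topologicalType) : final_family (@sum_incl X Y).
Proof.
split=> [[x|y]|U oU]; first by exists true, x.
  by exists false, y.
by split; [exact: (oU true)|exact: (oU false)].
Qed.

Lemma cts_sum (X Y W : topologicalType) (f : (X + Y)%type -> W) :
  cts (fun x => f (inl x)) -> cts (fun y => f (inr y)) -> cts f.
Proof. by move=> fl fr; apply: (cts_final (@sum_final X Y)); case. Qed.

Lemma cts_sum_itv (X Y W : topologicalType)
    (f : (X + Y)%type * unit_itv R -> W) :
  cts (fun p : X * unit_itv R => f (inl p.1, p.2)) ->
  cts (fun p : Y * unit_itv R => f (inr p.1, p.2)) -> cts f.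
Proof. by move=> fl fr; apply: (cts_final_itv (@sum_final X Y)); case. Qed.

Lemma quot_final (X : topologicalType) (e : X -> X -> Prop) :
  final_family (fun _ : unit => quot_pi e).
Proof.
split=> [x|U /(_ tt)//]; exists tt, (repr x); exact: reprK.
Qed.

Lemma cts_quot_pi (X : topologicalType) (e : X -> X -> Prop) :
  cts (quot_pi e).
Proof. exact: pi_continuous. Qed.

Lemma cts_quot (X W : topologicalType) (e : X -> X -> Prop) (f : quot e -> W) :
  cts (fun x => f (quot_pi e x)) -> cts f.
Proof. by move=> cf; apply: (cts_final (quot_final e)). Qed.

Lemma cts_quot_itv (X W : topologicalType) (e : X -> X -> Prop)
    (f : quot e * unit_itv R -> W) :
  cts (fun p : X * unit_itv R => f (quot_pi e p.1, p.2)) -> cts f.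
Proof. by move=> cf; apply: (cts_final_itv (quot_final e)). Qed.

Definition quot_fun (X : topologicalType) (W : Type) (e : X -> X -> Prop)
  (f : X -> W) : quot e -> W := f \o repr.

Lemma quot_funE (X : topologicalType) (W : Type) (e : X -> X -> Prop)
    (f : X -> W) :
  (forall x y, e x y -> f x = f y) ->
  forall x, quot_fun f (quot_pi e x) = f x.
Proof.
move=> ef x; have /quot_piP : quot_pi e (repr (quot_pi e x)) = quot_pi e x.
  exact: reprK.
rewrite /quot_fun /=; move: (repr _) => z.
by elim=> {x z} [x y /ef//|//|x y _ ->//|x y z _ -> _ ->].
Qed.

Lemma quot_ind (X : topologicalType) (e : X -> X -> Prop) (Q : quot e -> Prop) :
  (forall x, Q (quot_pi e x)) -> forall z, Q z.
Proof. by move=> Qpi z; rewrite -[z]reprK; exact: Qpi. Qed.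

End glued_spaces.

Section wedge.
Variables (R : realType) (X Y : ptopologicalType).

Definition wl (x : X) : pwedge2 X Y := @pwedge2_lift X Y true x.
Definition wr (y : Y) : pwedge2 X Y := @pwedge2_lift X Y false y.

Lemma wl_point : wl point = wr point.
Proof. exact: pwedge2_lift_point. Qed.

Lemma pwedge2_point : point = wl point :> pwedge2 X Y.
Proof. exact: (@wedge_liftE _ (wedge_summand X Y) (fun=> point) true point point point). Qed.

Lemma cts_wl : cts wl.
Proof.
exact: (@wedge_lift_continuous bool (wedge_summand X Y) (fun=> point) true).
Qed.

Lemma cts_wr : cts wr.
Proof.
exact: (@wedge_lift_continuous bool (wedge_summand X Y) (fun=> point) false).
Qed.

Lemma pwedge2_ind (Q : pwedge2 X Y -> Prop) :
  (forall x, Q (wl x)) -> (forall y, Q (wr y)) -> forall z, Q z.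
Proof.
move=> Ql Qr z; have : [set: pwedge2 X Y] z by [].
have <- := @wedgeTE bool (wedge_summand X Y) (fun=> point).
by case=> -[] _ [x _ <-]; [exact: Ql|exact: Qr].
Qed.

Lemma wedge_final : final_family (@pwedge2_lift X Y).
Proof.
split=> [|U oU]; last by apply/wedge_openP => i; exact: oU.
by apply: pwedge2_ind => x; [exists true, x|exists false, x].
Qed.

Lemma cts_wedge (W : topologicalType) (f : pwedge2 X Y -> W) :
  cts (fun x => f (wl x)) -> cts (fun y => f (wr y)) -> cts f.
Proof. by move=> fl fr; apply: (cts_final wedge_final); case. Qed.

Lemma cts_wedge_itv (W : topologicalType) (f : pwedge2 X Y * unit_itv R -> W) :
  cts (fun p : X * unit_itv R => f (wl p.1, p.2)) ->
  cts (fun p : Y * unit_itv R => f (wr p.1, p.2)) -> cts f.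
Proof. by move=> fl fr; apply: (cts_final_itv wedge_final); case. Qed.

Definition wedge_rec (W : Type) (f : X -> W) (g : Y -> W) : pwedge2 X Y -> W :=
  wedge_fun (fun i : bool => match i return wedge_summand X Y i -> W with
                             | true => f | false => g end).

Let wedge_recP (W : Type) (f : X -> W) (g : Y -> W) (i j : bool) :
  f point = g point ->
  match i return wedge_summand X Y i -> W with true => f | false => g end point
  = match j return wedge_summand X Y j -> W with true => f | false => g end
      point.
Proof. by case: i; case: j. Qed.

Lemma wedge_rec_wl (W : Type) (f : X -> W) (g : Y -> W) :
  f point = g point -> forall x, wedge_rec f g (wl x) = f x.
Proof.
move=> fg x; apply: (@wedge_lift_funE _ (wedge_summand X Y) _ _ _ true x).
by move=> i j; exact: wedge_recP.
Qed.

Lemma wedge_rec_wr (W : Type) (f : X -> W) (g : Y -> W) :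
  f point = g point -> forall y, wedge_rec f g (wr y) = g y.
Proof.
move=> fg x; apply: (@wedge_lift_funE _ (wedge_summand X Y) _ _ _ false x).
by move=> i j; exact: wedge_recP.
Qed.

End wedge.

Ltac cts_known :=
  lazymatch goal with
  | |- cts inl => exact: cts_inl
  | |- cts inr => exact: cts_inr
  | |- cts (quot_pi _) => exact: cts_quot_pi
  | |- cts (@wl _ _) => exact: cts_wl
  | |- cts (@wr _ _) => exact: cts_wr
  end.

Ltac cts_step :=
  lazymatch goal with
  | |- cts (fun p => p) => exact (@cts_id _)
  | |- cts (@fst _ _) => apply: cts_fst; exact: cts_id
  | |- cts (@snd _ _) => apply: cts_snd; exact: cts_id
  | |- cts (fun _ => ?c) => exact (@cts_cst _ _ c)
  | |- cts (fun p => (@?f p, @?g p)) => apply: (@cts_pair _ _ _ f g)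
  | |- cts (fun p => fst (@?f p)) => apply: (@cts_fst _ _ _ f)
  | |- cts (fun p => snd (@?f p)) => apply: (@cts_snd _ _ _ f)
  | |- cts (fun p => uval (@?f p)) => apply: (@cts_uval _ _ f)
  | |- cts (fun p => clamp (@?f p)) => apply: (@cts_clamp _ _ f)
  | |- cts (fun p => (@?f p) + (@?g p)) => apply: (@cts_add _ _ f g)
  | |- cts (fun p => - (@?f p)) => apply: (@cts_opp _ _ f)
  | |- cts (fun p => (@?f p) * (@?g p)) => apply: (@cts_mul _ _ f g)
  | |- cts (fun p => Num.max (@?f p) (@?g p)) => apply: (@cts_max _ _ f g)
  | |- cts (fun p => Num.min (@?f p) (@?g p)) => apply: (@cts_min _ _ f g)
  | |- cts (fun p => ifle (@?a p) (@?b p) (@?f p) (@?g p)) =>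
      apply: (@cts_ifle _ _ _ a b f g)
  | |- cts (fun p => ?h (@?f p)) => apply: (@cts_comp _ _ _ h f)
  end.

(** For piecewise formulas, what remains to be shown is the agreement of the branches at the
    breakpoints. *)
Ltac cts_auto :=
  repeat (first [match goal with cf : cts ?f |- cts ?f => exact cf end
                | cts_known | cts_step]).

(** * Pointed homotopies *)

Section pointed_homotopy.
Variable R : realType.

Lemma ph_refl (X Y : ptopologicalType) (f : X -> Y) :
  pointed_map f -> pointed_homotopic R f f.
Proof.
move=> [cf f0]; exists (fun p => f p.1); split => //.
have cf' : cts f by [].
by change (cts (fun p : X * unit_itv R => f p.1)); cts_auto.
Qed.

Lemma ph_sym (X Y : ptopologicalType) (f g : X -> Y) :
  pointed_homotopic R f g -> pointed_homotopic R g f.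
Proof.
move=> [K [cK K0 K1 Kp]]; exists (fun p => K (p.1, clamp (1 - uval p.2))).
split=> [|x|x|t] //=.
- have {}cK : cts K by [].
  by change (cts (fun p : X * unit_itv R => K (p.1, clamp (1 - uval p.2)))); cts_auto.
- by rewrite clamp_ge1// uval0 subr0.
- by rewrite clamp_le0// uval1 subrr.
Qed.

Lemma ph_trans (X Y : ptopologicalType) (f g h : X -> Y) :
  pointed_homotopic R f g -> pointed_homotopic R g h ->
  pointed_homotopic R f h.
Proof.
move=> [K [cK K0 K1 Kp]] [L [cL L0 L1 Lp]].
pose M (p : X * unit_itv R) := 
  ifle (uval p.2) 2^-1 (K (p.1, clamp (2 * uval p.2)))
       (L (p.1, clamp (2 * uval p.2 - 1))).
exists M; rewrite /M; split=> [|x|x|t] /=.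
- have {}cK : cts K by []. have {}cL : cts L by [].
  change (cts M); rewrite /M; cts_auto.
  by move=> -[x t] /= ->; rewrite clamp_ge1 ?clamp_le0 ?K1 ?L0//; lra.
- by rewrite uval0 ifleT ?clamp_le0//; lra.
- by rewrite uval1 ifleF ?clamp_ge1//; lra.
- by rewrite Kp Lp /ifle; case: ifP.
Qed.

Lemma ph_comp (X Y Z : ptopologicalType) (f f' : X -> Y) (g g' : Y -> Z) :
  pointed_map f -> pointed_map g' ->
  pointed_homotopic R f f' -> pointed_homotopic R g g' ->
  pointed_homotopic R (g \o f) (g' \o f').
Proof.
move=> [cf f0] [cg g0] [K [cK K0 K1 Kp]] [L [cL L0 L1 Lp]].
apply: (@ph_trans _ _ _ (g' \o f)).
  exists (fun p => L (f p.1, p.2)); split=> //= [|t]; last by rewrite f0.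
  have {}cf : cts f by []. have {}cL : cts L by [].
  by change (cts (fun p : X * unit_itv R => L (f p.1, p.2))); cts_auto.
exists (fun p => g' (K p)); split=> /= [|x|x|t].
- have {}cg : cts g' by []. have {}cK : cts K by [].
  by change (cts (fun p : X * unit_itv R => g' (K p))); cts_auto.
- by rewrite K0.
- by rewrite K1.
- by rewrite Kp.
Qed.

Lemma pm_comp (X Y Z : ptopologicalType) (f : X -> Y) (g : Y -> Z) :
  pointed_map f -> pointed_map g -> pointed_map (g \o f).
Proof.
move=> [cf f0] [cg g0]; split; last by rewrite /= f0.
exact: (cts_comp (g := g) (f := f)).
Qed.

Lemma pm_id (X : ptopologicalType) : pointed_map (idfun : X -> X).
Proof. by split=> //; exact: (@cts_id X). Qed.

Lemma he_comp (X Y Z : ptopologicalType) (f : X -> Y) (g : Y -> Z) :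
  pointed_homotopy_equivalence R f -> pointed_homotopy_equivalence R g ->
  pointed_homotopy_equivalence R (g \o f).
Proof.
move=> [pf [f' [pf' ff' f'f]]] [pg [g' [pg' gg' g'g]]].
split; first exact: pm_comp.
exists (f' \o g'); split; first exact: pm_comp.
- apply: ph_trans ff'.
  apply: (@ph_comp _ _ _ (g' \o (g \o f)) f f' f') => //.
  + by apply: pm_comp => //; exact: pm_comp.
  + by apply: (@ph_comp _ _ _ f f (g' \o g) idfun) => //;
      [exact: pm_id|exact: ph_refl].
  + exact: ph_refl.
- apply: ph_trans g'g.
  apply: (@ph_comp _ _ _ (f \o (f' \o g')) g' g g) => //.
  + by apply: pm_comp => //; exact: pm_comp.
  + by apply: (@ph_comp _ _ _ g' g' (f \o f') idfun) => //;
      [exact: pm_id|exact: ph_refl].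
  + exact: ph_refl.
Qed.

Lemma he_inv (X Y : ptopologicalType) (f : X -> Y) (g : Y -> X) :
  pointed_map f -> pointed_map g ->
  pointed_homotopic R (g \o f) idfun -> pointed_homotopic R (f \o g) idfun ->
  pointed_homotopy_equivalence R g.
Proof. by move=> *; split=> //; exists f; split. Qed.

(* [S] is the only fibre of [p] that is not a point, and [D] contracts it through
   maps preserving it, so that [D (_, itv1)] descends to an inverse of [p]. *)
Lemma collapse_he (raw : topologicalType) (X' X : ptopologicalType)
    (e : raw -> raw -> Prop) (pi : raw -> X) (sigma : raw -> X') (p : X' -> X)
    (S : set X') (D : X' * unit_itv R -> X') :
  final_family (fun _ : unit => pi) ->
  (forall a b, pi a = pi b -> clos_refl_sym_trans _ e a b) ->
  cts sigma -> cts p -> (forall a, p (sigma a) = pi a) ->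
  (forall a b, e a b -> sigma a = sigma b \/ S (sigma a) /\ S (sigma b)) ->
  (forall x, S x -> p x = point) -> S point ->
  (exists a, S (sigma a)) ->
  (forall x, S x \/ exists a, x = sigma a) ->
  cts D -> (forall x, D (x, itv0) = x) -> (forall t, D (point, t) = point) ->
  (forall x t, S x -> S (D (x, t))) -> (forall x, S x -> D (x, itv1) = point) ->
  pointed_homotopy_equivalence R p.
Proof.
move=> pif pie cs cp psE eS Sp S0 [a0 Sa0] Ssig cD D0 Dp DS D1.
have sE a b : pi a = pi b -> sigma a = sigma b \/ S (sigma a) /\ S (sigma b).
  move=> /pie; elim=> {a b} [a b /eS//|a|a b _ []|a b c _ ab _ bc].
  - by left.
  - by move=> ->; left.
  - by move=> [Sa Sb]; right.
  case: ab bc => [->//|[Sa Sb]] [<-|[_ Sc]]; by right.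
have pS b : p (sigma b) = point -> S (sigma b).
  rewrite -(Sp _ Sa0) !psE => /sE[->//|[]//].
have pE x y : p x = p y -> x = y \/ S x /\ S y.
  case: (Ssig x) => [Sx|[a ->]]; case: (Ssig y) => [Sy|[b ->]].
  - by right.
  - by rewrite (Sp _ Sx) => /esym/pS; right.
  - by rewrite (Sp _ Sy) => /pS; right.
  - by rewrite !psE => /sE.
(* [s] is a section of sets only. Two choices differ within [S], where [D] ends at the basepoint and
   [p] is constant, so [spD] and [pDs] make the maps built from [s] independent of it. *)
have /choice[s sK] : forall x, exists y, p y = x.
  by move=> x; have [_ [a <-]] := pif.1 x; exists (sigma a).
have p0 : p point = point by exact: Sp.
have spD x : D (s (p x), itv1) = D (x, itv1).
  by have /pE[->//|[? ?]] : p (s (p x)) = p x by []; rewrite !D1.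
have pDs x t : p (D (s (p x), t)) = p (D (x, t)).
  have /pE[->//|[? ?]] : p (s (p x)) = p x by [].
  by rewrite [LHS]Sp ?[RHS]Sp//; exact: DS.
pose g x := D (s x, itv1).
(* Continuity on [X] is tested on [raw], where [sigma] takes the place of the discontinuous [s]. *)
have cg : cts g.
  apply: (cts_final pif) => _; rewrite /g.
  rewrite (_ : (fun _ => _) = fun a => D (sigma a, itv1)).
    by cts_auto.
  by apply/funext => a; rewrite -psE spD.
split; first by [].
exists g; split.
- by split=> //; rewrite /g -p0 spD Dp.
- apply: ph_sym; exists D; split => // x; by rewrite /g /= spD.
apply: ph_sym; exists (fun q => p (D (s q.1, q.2))); split => //= [|x|t].
- apply: (cts_final_itv pif) => _ /=.
  rewrite (_ : (fun _ => _) = fun q => p (D (sigma q.1, q.2))); first by cts_auto.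
  by apply/funext => q; rewrite -psE pDs.
- by rewrite D0.
- by rewrite -p0 pDs Dp.
Qed.

End pointed_homotopy.

(** * Double mapping cylinders *)

Section double_mapping_cylinder.
Variables (R : realType) (X Y Z : ptopologicalType) (g : X -> Y) (h : X -> Z).

Inductive uh_rel : Y + X * unit_itv R + Z -> Y + X * unit_itv R + Z -> Prop :=
| uh_rel0 x : uh_rel (inl (inr (x, itv0))) (inl (inl (g x)))
| uh_rel1 x : uh_rel (inl (inr (x, itv1))) (inr (h x)).

Definition uh := quot uh_rel.

HB.instance Definition _ := Topological.on uh.
HB.instance Definition _ :=
  isPointed.Build uh (quot_pi uh_rel (inl (inl point))).

Definition uY (y : Y) : uh := quot_pi uh_rel (inl (inl y)).
Definition uX (q : X * unit_itv R) : uh := quot_pi uh_rel (inl (inr q)).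
Definition uZ (z : Z) : uh := quot_pi uh_rel (inr z).

Lemma uX0 x : uX (x, itv0) = uY (g x).
Proof. by apply/quot_piP; apply: rst_step; exact: uh_rel0. Qed.

Lemma uX1 x : uX (x, itv1) = uZ (h x).
Proof. by apply/quot_piP; apply: rst_step; exact: uh_rel1. Qed.

Lemma cts_uY : cts uY.
Proof. by rewrite /uY; cts_auto. Qed.

Lemma cts_uX : cts uX.
Proof. by rewrite /uX; cts_auto. Qed.

Lemma cts_uZ : cts uZ.
Proof. by rewrite /uZ; cts_auto. Qed.

Lemma uh_ind (Q : uh -> Prop) :
  (forall y, Q (uY y)) -> (forall q, Q (uX q)) -> (forall z, Q (uZ z)) ->
  forall w, Q w.
Proof.
move=> QY QX QZ; apply: (@quot_ind _ uh_rel) => -[[y|q]|z];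
  [exact: QY|exact: QX|exact: QZ].
Qed.

Lemma cts_uh (W : topologicalType) (f : uh -> W) :
  cts (fun y => f (uY y)) -> cts (fun q => f (uX q)) ->
  cts (fun z => f (uZ z)) -> cts f.
Proof.
by move=> fY fX fZ; apply: cts_quot; apply: cts_sum => //; exact: cts_sum.
Qed.

Lemma cts_uh_itv (W : topologicalType) (f : uh * unit_itv R -> W) :
  cts (fun p : Y * unit_itv R => f (uY p.1, p.2)) ->
  cts (fun p : (X * unit_itv R) * unit_itv R => f (uX p.1, p.2)) ->
  cts (fun p : Z * unit_itv R => f (uZ p.1, p.2)) -> cts f.
Proof.
move=> fY fX fZ; apply: cts_quot_itv.
by apply: cts_sum_itv => //; exact: cts_sum_itv.
Qed.

Section recursor.
Variables (W : Type) (fY : Y -> W) (fX : X * unit_itv R -> W) (fZ : Z -> W).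

Definition uh_rec : uh -> W :=
  quot_fun (fun p => match p with
                     | inl (inl y) => fY y
                     | inl (inr q) => fX q
                     | inr z => fZ z
                     end).

Hypothesis fX0 : forall x, fX (x, itv0) = fY (g x).
Hypothesis fX1 : forall x, fX (x, itv1) = fZ (h x).

Let uh_recE p : uh_rec (quot_pi uh_rel p) = match p with
  | inl (inl y) => fY y | inl (inr q) => fX q | inr z => fZ z end.
Proof. by rewrite /uh_rec quot_funE//; move=> _ _ []. Qed.

Lemma uh_recY y : uh_rec (uY y) = fY y. Proof. exact: uh_recE. Qed.
Lemma uh_recX q : uh_rec (uX q) = fX q. Proof. exact: uh_recE. Qed.
Lemma uh_recZ z : uh_rec (uZ z) = fZ z. Proof. exact: uh_recE. Qed.

End recursor.

Lemma cts_uh_rec (W : topologicalType) fY fX fZ :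
  (forall x, fX (x, itv0) = fY (g x)) -> (forall x, fX (x, itv1) = fZ (h x)) ->
  cts fY -> cts fX -> cts fZ -> cts (@uh_rec W fY fX fZ).
Proof.
move=> f0 f1 cY cX cZ; apply: cts_uh.
- by under eq_fun do rewrite uh_recY//.
- by under eq_fun do rewrite uh_recX//.
- by under eq_fun do rewrite uh_recZ//.
Qed.

Lemma uh_homotopy (W : topologicalType) (kY : Y * unit_itv R -> W)
    (kX : (X * unit_itv R) * unit_itv R -> W) (kZ : Z * unit_itv R -> W) :
  (forall x s, kX ((x, itv0), s) = kY (g x, s)) ->
  (forall x s, kX ((x, itv1), s) = kZ (h x, s)) ->
  cts kY -> cts kX -> cts kZ ->
  exists K : uh * unit_itv R -> W,
    [/\ cts K, forall y s, K (uY y, s) = kY (y, s),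
      forall q s, K (uX q, s) = kX (q, s) &
      forall z s, K (uZ z, s) = kZ (z, s)].
Proof.
move=> k0 k1 cY cX cZ.
pose K (p : uh * unit_itv R) : W := uh_rec (fun y => kY (y, p.2))
  (fun q => kX (q, p.2)) (fun z => kZ (z, p.2)) p.1.
have KY y s : K (uY y, s) = kY (y, s) by rewrite /K uh_recY.
have KX q s : K (uX q, s) = kX (q, s) by rewrite /K uh_recX.
have KZ z s : K (uZ z, s) = kZ (z, s) by rewrite /K uh_recZ.
exists K; split=> //; apply: cts_uh_itv.
- by under eq_fun do rewrite KY -surjective_pairing.
- by under eq_fun do rewrite KX -surjective_pairing.
- by under eq_fun do rewrite KZ -surjective_pairing.
Qed.

(** The basepoint lies at the end [Y], so being pointed is a condition on [kY] alone. *)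
Lemma uh_ph (W : ptopologicalType) (f0 f1 : uh -> W) (kY : Y * unit_itv R -> W)
    (kX : (X * unit_itv R) * unit_itv R -> W) (kZ : Z * unit_itv R -> W) :
  (forall x s, kX ((x, itv0), s) = kY (g x, s)) ->
  (forall x s, kX ((x, itv1), s) = kZ (h x, s)) ->
  cts kY -> cts kX -> cts kZ ->
  (forall y, kY (y, itv0) = f0 (uY y)) -> (forall y, kY (y, itv1) = f1 (uY y)) ->
  (forall x t, kX ((x, t), itv0) = f0 (uX (x, t))) ->
  (forall x t, kX ((x, t), itv1) = f1 (uX (x, t))) ->
  (forall z, kZ (z, itv0) = f0 (uZ z)) -> (forall z, kZ (z, itv1) = f1 (uZ z)) ->
  (forall s, kY (point, s) = point) ->
  pointed_homotopic R f0 f1.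
Proof.
move=> k0 k1 cY cX cZ kY0 kY1 kX0 kX1 kZ0 kZ1 kp.
have [K [cK KY KX KZ]] := uh_homotopy k0 k1 cY cX cZ.
exists K; split=> //.
- by apply: uh_ind => [y|[x t]|z]; rewrite ?KY ?KX ?KZ.
- by apply: uh_ind => [y|[x t]|z]; rewrite ?KY ?KX ?KZ.
- by move=> s; rewrite -[point]/(uY point) KY.
Qed.

End double_mapping_cylinder.

Arguments uY {R X Y Z} g h y.
Arguments uX {R X Y Z} g h q.
Arguments uZ {R X Y Z} g h z.

Ltac cts_known ::=
  lazymatch goal with
  | |- cts inl => exact: cts_inl
  | |- cts inr => exact: cts_inr
  | |- cts (quot_pi _) => exact: cts_quot_pi
  | |- cts (@wl _ _) => exact: cts_wl
  | |- cts (@wr _ _) => exact: cts_wr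
  | |- cts (uY _ _) => exact: cts_uY
  | |- cts (uX _ _) => exact: cts_uX
  | |- cts (uZ _ _) => exact: cts_uZ
  end.

(** * Changing a leg of the pushout by a homotopy *)

Section homotopic_attaching_maps.
Variables (R : realType) (X Y Z : ptopologicalType) (g : X -> Y).

Definition attach_path (h0 : X -> Z) (H : X * unit_itv R -> Z)
    (q : X * unit_itv R) : uh R g h0 :=
  ifle (uval q.2) 2^-1 (uX g h0 (q.1, clamp (2 * uval q.2)))
    (uZ g h0 (H (q.1, clamp (2 * uval q.2 - 1)))).

(** The direction is opposite to that of [H]: the image of the segment over [x] has to end at
    [h1 x], so it crosses the cylinder of [h0] and then follows [H] from [h0 x] to [h1 x]. *)
Definition attach (h0 h1 : X -> Z) (H : X * unit_itv R -> Z) :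
    uh R g h1 -> uh R g h0 :=
  uh_rec (uY g h0) (attach_path h0 H) (uZ g h0).

Arguments attach h0 h1 H : clear implicits.

Section attach_theory.
Variables (h0 h1 : X -> Z) (H : X * unit_itv R -> Z).
Hypotheses (cH : cts H) (H0 : forall x, H (x, itv0) = h0 x).
Hypothesis (H1 : forall x, H (x, itv1) = h1 x).

Let path0 x : attach_path h0 H (x, itv0) = uY g h0 (g x).
Proof. by rewrite /attach_path uval0 ifleT ?clamp_le0 ?uX0//=; lra. Qed.

Let path1 x : attach_path h0 H (x, itv1) = uZ g h0 (h1 x).
Proof. by rewrite /attach_path uval1 ifleF ?clamp_ge1 ?H1//=; lra. Qed.

Lemma attachY y : attach h0 h1 H (uY g h1 y) = uY g h0 y.
Proof. exact: uh_recY. Qed.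

Lemma attachX x t : attach h0 h1 H (uX g h1 (x, t)) =
  ifle (uval t) 2^-1 (uX g h0 (x, clamp (2 * uval t)))
       (uZ g h0 (H (x, clamp (2 * uval t - 1)))).
Proof. exact: uh_recX. Qed.

Lemma attachZ z : attach h0 h1 H (uZ g h1 z) = uZ g h0 z.
Proof. exact: uh_recZ. Qed.

Lemma attach_pm : pointed_map (attach h0 h1 H : uh R g h1 -> uh R g h0).
Proof.
split; last exact: attachY.
apply: cts_uh_rec => //; [by cts_auto| |by cts_auto].
rewrite /attach_path. cts_auto; move=> q /= ->.
by rewrite clamp_ge1 ?clamp_le0 ?H0 ?uX1//; lra.
Qed.

End attach_theory.

(* Both ends of the cylinder being fixed, the composite only reparametrizes the
   path [(x, t)] followed by [H (x, t)], which is contracted linearly. *)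
Lemma attachK (h0 h1 : X -> Z) (H H' : X * unit_itv R -> Z) :
  cts H -> (forall x, H (x, itv0) = h0 x) -> (forall x, H (x, itv1) = h1 x) ->
  (forall x t, H' (x, t) = H (x, clamp (1 - uval t))) ->
  pointed_homotopic R (attach h0 h1 H \o attach h1 h0 H')
    (idfun : uh R g h0 -> uh R g h0).
Proof.
move=> cH H0 H1 HH'.
have H'0 x : H' (x, itv0) = h1 x by rewrite HH' clamp_ge1// uval0 subr0.
have H'1 x : H' (x, itv1) = h0 x by rewrite HH' clamp_le0// uval1 subrr.
(* The path of length 2 over [x]: the cylinder on [[0, 1]], then [H] on [[1, 2]]. *)
pose W (p : X * R) := ifle p.2 1 (uX g h0 (p.1, clamp p.2))
  (uZ g h0 (H (p.1, clamp (p.2 - 1)))).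
have WX x u : u <= 1 -> W (x, u) = uX g h0 (x, clamp u) by move=> u1; rewrite /W ifleT.
have WZ x u : 1 <= u -> W (x, u) = uZ g h0 (H (x, clamp (u - 1))).
  move=> u1; rewrite /W /= ifle_ge// => ->.
  by rewrite subrr clamp_ge1// clamp_le0// H0 uX1.
have cW : cts W.
  rewrite /W; cts_auto => p /= ->.
  by rewrite subrr clamp_ge1// clamp_le0// H0 uX1.
(* The composite is [W (x, alpha t)]: [alpha] climbs to 2 at [t = 1/2], through the cylinder and all
   of [H], and returns to 1 as [H'] undoes [H]. Since [alpha t] and [t] agree at 0 and 1,
   interpolating between them keeps the ends fixed. *)
pose alpha (t : R) := Num.min (4 * t) (3 - 2 * t).
apply: (@uh_ph R X Y Z g h0 _ _ _ (fun p => uY g h0 p.1)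
  (fun p => W (p.1.1, (1 - uval p.2) * alpha (uval p.1.2) + uval p.2 * uval p.1.2))
  (fun p => uZ g h0 p.1)) => //=.
- move=> x s; rewrite uval0 /alpha !mulr0 subr0 min_l ?ler0n// mulr0 addr0.
  by rewrite WX// clamp_le0// uX0.
- move=> x s; rewrite uval1 /alpha min_r; last lra.
  by rewrite (_ : _ + _ = 1); [rewrite WX// clamp_ge1// uX1|lra].
- by cts_auto.
- by rewrite /alpha; cts_auto.
- by cts_auto.
- by move=> y; rewrite !attachY.
- move=> x t; rewrite uval0 subr0 mul1r mul0r addr0.
  have t0 := uval_ge0 t; have t1 := uval_le1 t.
  rewrite attachX//; case: (leP (uval t) 2^-1) => t2.
    rewrite ifleT// attachX// clampE; last lra.
    rewrite /alpha min_l; last lra.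
    case: (leP (2 * uval t) 2^-1) => t4.
      by rewrite ifleT// WX; [congr (uX _ _ (_, clamp _)); lra|lra].
    by rewrite ifleF// WZ; [congr (uZ _ _ (H (_, clamp _))); lra|lra].
  rewrite ifleF// attachZ// HH' clampE; last lra.
  rewrite /alpha min_r; last lra.
  by rewrite WZ; [congr (uZ _ _ (H (_, clamp _))); lra|lra].
- move=> x t; rewrite uval1 subrr mul0r add0r mul1r WX ?clampK//.
  exact: uval_le1.
- by move=> z; rewrite !attachZ.
Qed.

Lemma attach_he (h0 h1 : X -> Z) (H : X * unit_itv R -> Z) :
  cts H -> (forall x, H (x, itv0) = h0 x) -> (forall x, H (x, itv1) = h1 x) ->
  pointed_homotopy_equivalence R (attach h0 h1 H : uh R g h1 -> uh R g h0).
Proof.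
move=> cH H0 H1; split; first exact: attach_pm.
pose H' p := H (p.1, clamp (1 - uval p.2)).
have cH' : cts H' by rewrite /H'; cts_auto.
have H'0 x : H' (x, itv0) = h1 x by rewrite /H'/= clamp_ge1// uval0 subr0.
have H'1 x : H' (x, itv1) = h0 x by rewrite /H'/= clamp_le0// uval1 subrr.
exists (attach h1 h0 H'); split.
- exact: attach_pm.
- apply: attachK => // x t; rewrite /H' /= clampE; last first.
    by have := uval_ge0 t; have := uval_le1 t; lra.
  by rewrite opprB addrC subrK clampK.
- exact: attachK.
Qed.

End homotopic_attaching_maps.

Arguments attach {R X Y Z} g h0 h1 H.

(** * Well-pointed spaces *)

(* [(X, point)] is an NDR pair. *)
Definition well_pointed (R : realType) (X : ptopologicalType) : Prop :=
  closed [set point : X] /\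
  exists (H : X * unit_itv R -> X) (lam : X -> unit_itv R),
    [/\ cts H, cts lam,
      (forall x, H (x, itv0) = x) /\ (forall t, H (point, t) = point),
      lam point = itv1 &
      forall x, 0 < uval (lam x) -> H (x, itv1) = point].

(** Both deformations run at once, and the two functions are multiplied: a product of nonnegative
    numbers is positive only where both factors are. This takes the place of a cell structure on the
    product. *)
Lemma well_pointed_prod (R : realType) (X Y : ptopologicalType) :
  well_pointed R X -> well_pointed R Y -> well_pointed R (X * Y)%type.
Proof.
move=> [cX [H [l [cH cl [H0 Hp] lp l1]]]] [cY [K [m [cK cm [K0 Kp] mp m1]]]].
split.
  rewrite (_ : [set _] = fst @^-1` [set point] `&` snd @^-1` [set point]).
    have cf : cts (@fst X Y) by apply: cts_fst; exact: cts_id.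
    have cs : cts (@snd X Y) by apply: cts_snd; exact: cts_id.
    by apply: closedI; [move/continuous_closedP: cf|move/continuous_closedP: cs];
      apply.
  by apply/seteqP; split=> [_ -> //|[x y] /= [-> ->]].
exists (fun p => (H (p.1.1, p.2), K (p.1.2, p.2))).
exists (fun p => clamp (uval (l p.1) * uval (m p.2))).
split=> //=; [by cts_auto|by cts_auto| | |].
- by split=> [[x y]|t] /=; rewrite ?H0 ?K0 ?Hp ?Kp.
- by rewrite lp mp !uval1 mulr1 clamp_ge1.
move=> [x y] /=; rewrite clampE; last first.
  by rewrite mulr_ge0 ?uval_ge0//= mulr_ile1 ?uval_ge0 ?uval_le1.
move=> lm; have [lx|lx] := ltP 0 (uval (l x)); last first.
  have := uval_ge0 (l x) => lx0.
  by move: lm; rewrite (@le_anti _ _ (uval (l x)) 0) ?lx ?lx0// mul0r ltxx.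
have [my|my] := ltP 0 (uval (m y)); last first.
  have := uval_ge0 (m y) => my0.
  by move: lm; rewrite (@le_anti _ _ (uval (m y)) 0) ?my ?my0// mulr0 ltxx.
by rewrite l1// m1.
Qed.

(* For each parameter [v] the map [i (v, _)] is deformed in such a way that the
   basepoint runs along [w (v, _)] during the second half of the time. *)
Lemma drag_basepoint (R : realType) (V X : ptopologicalType)
    (W : topologicalType) (i : V * X -> W) (w : V * unit_itv R -> W) :
  well_pointed R X -> cts i -> cts w ->
  (forall v, w (v, itv0) = i (v, point)) ->
  exists G : V * X * unit_itv R -> W,
    [/\ cts G, forall v x, G ((v, x), itv0) = i (v, x) &
      forall v t, G ((v, point), t) = w (v, clamp (2 * uval t - 1))].
Proof.
move=> [clX [H [l [cH cl [H0 Hp] lp l1]]]] ci cw w0.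
pose k (p : V * X * unit_itv R) := H (p.1.2, clamp (2 * uval p.2)).
pose m (p : V * X * unit_itv R) := uval (clamp (2 * uval p.2 - 1)) * uval (l p.1.2).
have m0 p : 0 <= m p by rewrite mulr_ge0 ?uval_ge0.
pose f p := i (p.1.1, k p).
pose f' (p : V * X * unit_itv R) := w (p.1.1, clamp (m p)).
pose G p := ifle (m p) 0 (f p) (f' p).
have Gk p : k p = point -> G p = f' p.
  rewrite /G /ifle; case: ifPn => // mp kp.
  by rewrite /f kp /f' (clamp_le0 mp) w0.
have ck : cts k by rewrite /k; cts_auto.
have cm : cts m by rewrite /m; cts_auto.
exists G; split.
(* Off the first set both [2t - 1] and [l x] are positive, so [H] has already brought [x] to the
   basepoint. The point then lies in the second set, which is closed because the basepoint is; [Gk]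
   settles the overlap. *)
- apply: (@cts_glue _ _ [set p | m p <= 0] (k @^-1` [set point]) f f').
  + by apply: closed_le_fun => //; exact: cts_cst.
  + by move/continuous_closedP: ck; apply.
  + move=> [[v x] t] /=; rewrite /k /m /=.
    have [|lx] := leP (uval (l x)) 0.
      by left; rewrite mulr_ge0_le0// uval_ge0.
    have [t2|t2] := leP (2 * uval t) 1; last first.
      by right; rewrite clamp_ge1 ?l1// ltW.
    by left; rewrite clamp_le0 ?mul0r//; lra.
  + by rewrite /f; cts_auto.
  + by rewrite /f'; cts_auto.
  + by move=> p mp; rewrite /G ifleT.
  + exact: Gk.
- move=> v x; rewrite /G /m /f /k /= uval0 ifleT.
    by rewrite clamp_le0 ?H0//; lra.
  by rewrite (@clamp_le0 _ (2 * 0 - 1)) ?mul0r//; lra.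
- move=> v t; rewrite Gk; last by rewrite /k /= Hp.
  by rewrite /f' /m /= lp uval1 mulr1 clampK.
Qed.

(** * Contracting the segment over the basepoint *)

Section segment.
Variables (R : realType) (X Y Z : ptopologicalType) (g : X -> Y) (h : X -> Z).
Hypotheses (ch : cts h) (gp : g point = point) (hp : h point = point).
Hypotheses (wpX : well_pointed R X) (wpZ : well_pointed R Z).

Definition segment : set (uh R g h) := [set uX g h (point, t) | t in setT].

(* [X x I] is first stretched near [{point} x I] relatively to its ends, then
   the segment is retracted to its initial point, dragging [Z] along. *)
Lemma segment_deformation : exists D : uh R g h * unit_itv R -> uh R g h,
  [/\ cts D, forall x, D (x, itv0) = x, forall t, D (point, t) = point,
    forall x t, segment x -> segment (D (x, t)) &
    forall x, segment x -> D (x, itv1) = point].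
Proof.
have [_ [H [l [cH cl [H0 Hp] lp l1]]]] := wpX.
(* The parameter is idle here and is set to [point] in [G]: [Z] is deformed while its basepoint
   travels down the segment to the end [Y]. *)
have [|||G' [cG' G'0 G'p]] := @drag_basepoint R X Z (uh R g h)
  (fun p => uZ g h p.2) (fun p => uX g h (point, clamp (1 - uval p.2))) wpZ.
- by cts_auto.
- by cts_auto.
- by move=> v /=; rewrite uval0 subr0 clamp_ge1// uX1 hp.
pose G p := G' ((point, p.1), p.2).
have {}G'0 z : G (z, itv0) = uZ g h z by exact: G'0.
have {}G'p t : G (point, t) = uX g h (point, clamp (1 - uval (clamp (2 * uval t - 1)))).
  exact: G'p.
have cG : cts G by rewrite /G; cts_auto.
move: G cG G'0 G'p => G cG G0 Gp {G' cG'}.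
(* The time granted to [H]: none at the two ends, which must not move yet, and all of it on the
   middle third. *)
pose om (t : unit_itv R) := clamp (Num.min (3 * uval t) (3 - 3 * uval t)).
pose sA (s : unit_itv R) := uval (clamp (2 * uval s)).
pose sB (s : unit_itv R) := uval (clamp (2 * uval s - 1)).
(* The cylinder coordinate after the first half: the outer thirds are pressed onto the two ends and
   the middle third runs through the whole cylinder. *)
pose mid (t : unit_itv R) := uval (clamp (3 * uval t - 1)).
(* The height of the dragged basepoint at time [u], as prescribed by [Gp]; used as a factor, it
   shrinks the segment at the same pace. *)
pose sg (u : R) := 1 - uval (clamp (2 * u - 1)).
pose A (p : X * unit_itv R * unit_itv R) :=
  uX g h (H (p.1.1, clamp (sA p.2 * uval (om p.1.2))),
          clamp ((1 - sA p.2) * uval p.1.2 + sA p.2 * mid p.1.2)).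
pose lx (p : X * unit_itv R * unit_itv R) := uval (l p.1.1).
pose B1 (p : X * unit_itv R * unit_itv R) :=
  uX g h (H (p.1.1, om p.1.2), clamp (mid p.1.2 * sg (sB p.2 * lx p))).
(* The time given to [G] is affine in [t], from [sB * l x] at [t = 2/3], where [B1] takes over, to
   [sB] at [t = 1], where [kZ] does. *)
pose B2 (p : X * unit_itv R * unit_itv R) :=
  G (h (H (p.1.1, om p.1.2)),
     clamp (sB p.2 * ((3 * uval p.1.2 - 2) + (3 - 3 * uval p.1.2) * lx p))).
pose kX p := ifle (uval p.2) 2^-1 (A p) (ifle (uval p.1.2) (2 / 3) (B1 p) (B2 p)).
pose kZ p := G (p.1, clamp (2 * uval p.2 - 1)).
have sg0 : sg 0 = 1 by rewrite /sg clamp_le0 ?subr0//; lra.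
have sg1 : sg 1 = 0 by rewrite /sg clamp_ge1 ?subrr//; lra.
have om0 t : uval t = 0 -> om t = itv0.
  by move=> t0; rewrite /om t0 clamp_le0// ge_min mulr0 lexx.
have om1 t : uval t = 1 -> om t = itv0.
  by move=> t0; rewrite /om t0 clamp_le0// ge_min; apply/orP; right; lra.
have omm t : 3^-1 <= uval t -> uval t <= 2 / 3 -> om t = itv1.
  by move=> t3 t23; rewrite /om clamp_ge1// le_min; apply/andP; split; lra.
have cA : cts A by rewrite /A /sA /om /mid; cts_auto.
have clx : cts lx by rewrite /lx; cts_auto.
have cB1 : cts B1 by rewrite /B1 /sB /om /mid /sg; cts_auto.
have cB2 : cts B2 by rewrite /B2 /sB /om; cts_auto.
have B12 p : uval p.1.2 = 2 / 3 -> B1 p = B2 p.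
  move: p => [[x t] s] /= t23; have ot : om t = itv1 by apply: omm; rewrite t23; lra.
  rewrite /B1 /B2 /= ot.
  rewrite /mid t23 (_ : 3 * _ - 1 = 1); last lra.
  rewrite clamp1 uval1 mul1r (_ : 3 * _ - 2 + _ = lx (x, t, s)); last lra.
  (* If [l x] is positive, [H] has reached the basepoint and both formulas follow the segment; if it
     is zero, both stay at the end [Z]. *)
  have [lx0|lx0] := ltP 0 (lx (x, t, s)).
    rewrite l1// hp Gp /sg; congr (uX _ _ (_, clamp (1 - uval (clamp (2 * _ - 1))))).
    by rewrite clampE// mulr_ge0 ?uval_ge0//= mulr_ile1 ?uval_ge0 ?uval_le1.
  rewrite (@le_anti _ _ (lx (x, t, s)) 0) ?uval_ge0 ?lx0// mulr0 sg0.
  by rewrite clamp0 G0 clamp1 uX1.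
have AB p : uval p.2 = 2^-1 -> A p = ifle (uval p.1.2) (2 / 3) (B1 p) (B2 p).
  move: p => [[x t] s] /= s2; rewrite /A /B1 /B2 /sA /sB /= s2.
  rewrite (@clamp_ge1 _ (2 * 2^-1)); last lra.
  rewrite (@clamp_le0 _ (2 * 2^-1 - 1)); last lra.
  rewrite uval0 uval1 !mul0r subrr mul0r add0r !mul1r !clampK sg0 mulr1 /ifle.
  case: ifPn => t23; first by rewrite /mid clampK.
  rewrite clamp0 G0.
  rewrite (@clamp_ge1 _ (3 * uval t - 1)) ?uX1//.
  by move: t23; rewrite -ltNge; lra.
have k0 x s : kX ((x, itv0), s) = uY g h (g x).
  rewrite /kX /A /B1 /= uval0 (ifleT _ _ (_ : 0 <= 2 / 3)); last lra.
  rewrite om0// H0 /mid uval0 (@clamp_le0 _ (3 * 0 - 1)); last lra.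
  by rewrite !(mulr0, addr0, mul0r) clamp_le0// H0 uX0 /ifle; case: ifP.
have k1 x s : kX ((x, itv1), s) = kZ (h x, s).
  rewrite /kX /A /B2 /kZ /= uval1 (@ifleF _ _ 1); last lra.
  rewrite om1// H0 uval0 mulr0 clamp_le0// H0.
  rewrite /mid uval1 (@clamp_ge1 _ (3 * 1 - 1)); last lra.
  rewrite uval1 !mulr1 subrK (@clamp_ge1 _ 1)// uX1.
  rewrite subrr mul0r addr0 (_ : 3 - 2 = 1); last lra.
  rewrite mulr1 /sB clampK /ifle; case: ifPn => // s2.
  by rewrite clamp_le0 ?G0//; lra.
have ckX : cts kX.
  by rewrite /kX; cts_auto.
have ckZ : cts kZ by rewrite /kZ; cts_auto.
have ckY : cts (fun p : Y * unit_itv R => uY g h p.1 : uh R g h) by cts_auto.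
have [D [cD DY DX DZ]] := uh_homotopy k0 k1 ckY ckX ckZ.
exists D; split=> //.
- apply: uh_ind => [y|[x t]|z]; rewrite ?DY ?DX ?DZ//=.
    rewrite /kX /A /= uval0 ifleT; last lra.
    rewrite (_ : sA itv0 = 0); last by rewrite /sA uval0 mulr0 clamp0.
    by rewrite subr0 !mul0r addr0 mul1r clampK clamp0 H0.
  by rewrite /kZ/= uval0 clamp_le0 ?G0//; lra.
- by move=> t; rewrite -[point]/(uY g h point) DY.
- move=> _ s [t _ <-]; rewrite DX /kX /A /B1 /B2 /= /ifle.
  case: ifPn => _; first by rewrite Hp; eexists.
  by case: ifPn => _; rewrite Hp ?hp ?Gp; eexists.
move=> _ [t _ <-]; rewrite DX /kX /B1 /B2 /= uval1 ifleF; last lra.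
rewrite /sB /lx /= uval1 Hp lp (@clamp_ge1 _ (2 * 1 - 1)); last lra.
rewrite uval1 !mul1r mulr1 sg1 mulr0 hp (_ : _ + _ = 1); last lra.
rewrite (@clamp_ge1 _ 1)// Gp (@clamp_ge1 _ (2 * _ - 1)); last by rewrite uval1; lra.
by rewrite uval1 subrr clamp_le0// uX0 gp /ifle; case: ifP.
Qed.

End segment.

Arguments segment {R X Y Z} g h _.

(** * The collapses onto the reduced pushout, the join and the half-smash *)

Section collapsed_segment.
Variable R : realType.

Section hpushout.
Variables (X Y Z : ptopologicalType) (g : X -> Y) (h : X -> Z).
Hypotheses (ch : cts h) (gp : g point = point) (hp : h point = point).
Hypotheses (wpX : well_pointed R X) (wpZ : well_pointed R Z).

Definition to_hpushout : uh R g h -> hpushout R g h :=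
  uh_rec (fun y => quot_pi (hpushout_rel g h) (inl (inl y)))
    (fun q => quot_pi (hpushout_rel g h) (inl (inr q)))
    (fun z => quot_pi (hpushout_rel g h) (inr z)).

Let eq0 x : quot_pi (@hpushout_rel R _ _ _ g h) (inl (inr (x, itv0))) =
  quot_pi (@hpushout_rel R _ _ _ g h) (inl (inl (g x))).
Proof. by apply/quot_piP; apply: rst_step; exact: hpushout_rel0. Qed.

Let eq1 x : quot_pi (@hpushout_rel R _ _ _ g h) (inl (inr (x, itv1))) =
  quot_pi (@hpushout_rel R _ _ _ g h) (inr (h x)).
Proof. by apply/quot_piP; apply: rst_step; exact: hpushout_rel1. Qed.

Lemma to_hpushoutE p :
  to_hpushout (quot_pi _ p) = quot_pi (hpushout_rel g h) p.
Proof.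
by case: p => [[y|q]|z]; [exact: uh_recY|exact: uh_recX|exact: uh_recZ].
Qed.

Lemma to_hpushout_he : pointed_homotopy_equivalence R to_hpushout.
Proof.
have [D [cD D0 Dp DS D1]] := segment_deformation ch gp hp wpX wpZ.
have S0 (t : unit_itv R) : segment g h (uX g h (point, t)) by exists t.
apply: (@collapse_he R _ (uh R g h) (hpushout R g h)
  (@hpushout_rel R _ _ _ g h) (quot_pi (@hpushout_rel R _ _ _ g h))
  (quot_pi (@uh_rel R _ _ _ g h)) to_hpushout (segment g h) D) => //.
- exact: quot_final.
- by move=> a b /quot_piP.
- exact: cts_quot_pi.
- by apply: cts_uh_rec => //; cts_auto.
- exact: to_hpushoutE.
- move=> _ _ [x|x|t]; [left; exact: uX0|left; exact: uX1|right].
  by split; exact: S0.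
- move=> _ [t _ <-]; rewrite to_hpushoutE.
  transitivity (quot_pi (@hpushout_rel R _ _ _ g h) (inl (inr (point, itv0)))).
    by apply/quot_piP; apply: rst_step; exact: hpushout_rel_point.
  by rewrite eq0 gp.
- by exists itv0 => //; rewrite uX0 gp.
- by exists (inl (inr (point, itv0))); exact: S0.
- by apply: quot_ind => p; right; exists p.
Qed.

End hpushout.

Section join.
Variables A B : ptopologicalType.
Hypotheses (wpA : well_pointed R A) (wpB : well_pointed R B).

(* The join before the segment over the basepoint is collapsed. *)
Definition ujoin := uh R (@fst A B) (@snd A B).

Definition to_join : ujoin -> reduced_join R A B :=
  uh_rec (fun x => quot_pi (@join_rel R A B) (x, itv0, point))
    (fun q => quot_pi (@join_rel R A B) (q.1.1, q.2, q.1.2))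
    (fun y => quot_pi (@join_rel R A B) (point, itv1, y)).

Let eq0 (p : A * B) : quot_pi (@join_rel R A B) (p.1, itv0, p.2) =
  quot_pi (@join_rel R A B) (p.1, itv0, point).
Proof. by apply/quot_piP; apply: rst_step; exact: join_rel0. Qed.

Let eq1 (p : A * B) : quot_pi (@join_rel R A B) (p.1, itv1, p.2) =
  quot_pi (@join_rel R A B) (point, itv1, p.2).
Proof. by apply/quot_piP; apply: rst_step; exact: join_rel1. Qed.

Lemma to_joinY x : to_join (uY _ _ x) = quot_pi _ (x, itv0, point).
Proof. exact: uh_recY. Qed.

Lemma to_joinX x y t : to_join (uX _ _ ((x, y), t)) = quot_pi _ (x, t, y).
Proof. exact: uh_recX. Qed.

Lemma to_joinZ y : to_join (uZ _ _ y) = quot_pi _ (point, itv1, y).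
Proof. exact: uh_recZ. Qed.

Lemma to_join_he : pointed_homotopy_equivalence R to_join.
Proof.
have csnd : cts (@snd A B) by apply: cts_snd; exact: cts_id.
have [D [cD D0 Dp DS D1]] := @segment_deformation R _ _ _ (@fst A B) snd
  csnd erefl erefl (well_pointed_prod wpA wpB) wpB.
have S0 (t : unit_itv R) : segment (@fst A B) snd (uX _ _ (point, t)) by exists t.
apply: (@collapse_he R _ ujoin (reduced_join R A B)
  (@join_rel R A B) (quot_pi (@join_rel R A B))
  (fun q => uX fst snd ((q.1.1, q.2), q.1.2)) to_join
  (segment (@fst A B) snd) D) => //.
- exact: quot_final.
- by move=> a b /quot_piP.
- by cts_auto.
- by apply: cts_uh_rec => //; cts_auto.
- by move=> [[x t] y]; exact: to_joinX.
- move=> _ _ [x y y'|x x' y|t] /=; [left|left|right].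
  + by rewrite !uX0.
  + by rewrite !uX1.
  + by split; exact: S0.
- move=> _ [t _ <-]; rewrite to_joinX; apply/quot_piP; apply: rst_step.
  exact: join_rel_point.
- by exists itv0 => //; exact: uX0.
- by exists (point, itv0, point); exact: S0.
- apply: uh_ind => [x|[[x y] t]|y]; right.
  + by exists (x, itv0, point); rewrite uX0.
  + by exists (x, t, y).
  + by exists (point, itv1, y); rewrite uX1.
Qed.

End join.

(** A cone is a double mapping cylinder with one end a point; this is that end. *)
Definition one_point := quot (fun _ _ : bool => True).

HB.instance Definition _ := Topological.on one_point.
HB.instance Definition _ :=
  isPointed.Build one_point (quot_pi (fun _ _ : bool => True) true).

Lemma one_pointE (x : one_point) : x = point.
Proof.
by elim/quot_ind: x => x; apply/quot_piP; exact: rst_step.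
Qed.

Section half_smash.
Variables C B : ptopologicalType.
Hypothesis wpC : well_pointed R C.

Definition cone_vertex (y : B) : one_point := point.
Definition cone_base (y : B) : (C * B)%type := (point, y).
(* The half-smash before the cone on [{point} x B] is collapsed. *)
Definition coned := uh R cone_vertex cone_base.

Definition to_half_smash : coned -> half_smash C B :=
  uh_rec (fun=> point : half_smash C B) (fun=> point)
    (fun z : C * B => quot_pi (@half_smash_rel C B) z).

Let eq1 y :
  (point : half_smash C B) = quot_pi (@half_smash_rel C B) (cone_base y).
Proof. by apply/quot_piP; apply: rst_step. Qed.

Lemma to_half_smashY x : to_half_smash (uY _ _ x) = point :> half_smash C B.
Proof. exact: uh_recY. Qed.

Lemma to_half_smashX q : to_half_smash (uX _ _ q) = point :> half_smash C B.
Proof. exact: uh_recX. Qed.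

Lemma to_half_smashZ z : to_half_smash (uZ _ _ z) = quot_pi _ z.
Proof. exact: uh_recZ. Qed.

Lemma to_half_smash_he : pointed_homotopy_equivalence R to_half_smash.
Proof.
(* [B] is the parameter space: over each [y], the copy of [C] is deformed while its basepoint climbs
   the cone line from [(point, y)] to the vertex. *)
have [|||G [cG G0 Gp]] := @drag_basepoint R B C coned
  (fun p => uZ cone_vertex cone_base (p.2, p.1))
  (fun p => uX cone_vertex cone_base (p.1, clamp (1 - uval p.2))) wpC.
- by cts_auto.
- by cts_auto.
- by move=> y /=; rewrite uval0 subr0 clamp1 uX1.
pose kY (p : one_point * unit_itv R) : coned := uY _ _ p.1.
(* The cone shrinks towards its vertex at the pace at which [G] moves its base. *)
pose kX (p : B * unit_itv R * unit_itv R) : coned :=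
  uX _ _ (p.1.1, clamp (uval p.1.2 * (1 - uval (clamp (2 * uval p.2 - 1))))).
pose kZ (p : C * B * unit_itv R) : coned := G ((p.1.2, p.1.1), p.2).
have k0 y s : kX ((y, itv0), s) = kY (cone_vertex y, s).
  by rewrite /kX /= mul0r clamp0 uX0.
have k1 y s : kX ((y, itv1), s) = kZ (cone_base y, s).
  by rewrite /kX /kZ /= Gp mul1r.
have cY : cts kY by rewrite /kY; cts_auto.
have cX : cts kX by rewrite /kX; cts_auto.
have cZ : cts kZ by rewrite /kZ; cts_auto.
have [D [cD DY DX DZ]] := uh_homotopy k0 k1 cY cX cZ.
(* The collapsed set is the whole cone. [uZ] reaches only its base, and the other points fall under
   the alternative [S x]. *)
apply: (@collapse_he R _ coned (half_smash C B)
  (@half_smash_rel C B) (quot_pi (@half_smash_rel C B))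
  (uZ cone_vertex cone_base) to_half_smash
  (range (uX cone_vertex cone_base)) D) => //.
- exact: quot_final.
- by move=> a b /quot_piP.
- by cts_auto.
- by apply: cts_uh_rec => //; cts_auto.
- exact: to_half_smashZ.
- move=> [c y] [c' y'] [/= -> ->]; right; split.
    by exists (y, itv1) => //; rewrite uX1.
  by exists (y', itv1) => //; rewrite uX1.
- by move=> _ [q _ <-]; exact: to_half_smashX.
- by exists (point, itv0) => //; rewrite uX0.
- by exists (point, point), (point, itv1) => //; rewrite uX1.
- apply: uh_ind => [x|q|z]; [left|left; by exists q|right; by exists z].
  by exists (point, itv0) => //; rewrite uX0 (one_pointE x).
- apply: uh_ind => [x|[y t]|[c y]]; rewrite ?DY ?DX ?DZ// /kX /kZ /=.
    rewrite uval0 (@clamp_le0 _ (2 * 0 - 1)); last lra.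
    by rewrite uval0 subr0 mulr1 clampK.
  exact: G0.
- by move=> t; rewrite -[point]/(uY cone_vertex cone_base point) DY.
- by move=> _ s [[y t] _ <-]; rewrite DX; eexists.
- move=> _ [[y t] _ <-]; rewrite DX /kX /= uval1 (@clamp_ge1 _ (2 * 1 - 1)); last lra.
  by rewrite uval1 subrr mulr0 clamp0 uX0.
Qed.

End half_smash.
End collapsed_segment.

(** * Homotopies and equivalences of wedges *)

Section wedge_homotopy.
Variable R : realType.

Lemma wedge_ph (X Y W : ptopologicalType) (f0 f1 : pwedge2 X Y -> W)
    (u0 u1 : X -> W) (v0 v1 : Y -> W) :
  (forall x, f0 (wl Y x) = u0 x) -> (forall x, f1 (wl Y x) = u1 x) ->
  (forall y, f0 (wr X y) = v0 y) -> (forall y, f1 (wr X y) = v1 y) ->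
  pointed_homotopic R u0 u1 -> pointed_homotopic R v0 v1 ->
  pointed_homotopic R f0 f1.
Proof.
move=> fu0 fu1 fv0 fv1 [K [cK K0 K1 Kp]] [L [cL L0 L1 Lp]].
have KL t : K (point, t) = L (point, t) by rewrite Kp Lp.
pose M (p : pwedge2 X Y * unit_itv R) :=
  wedge_rec (fun x => K (x, p.2)) (fun y => L (y, p.2)) p.1.
have Ml x t : M (wl Y x, t) = K (x, t) by rewrite /M wedge_rec_wl.
have Mr x t : M (wr X x, t) = L (x, t) by rewrite /M wedge_rec_wr.
exists M; split.
- apply: cts_wedge_itv.
    by under eq_fun do rewrite Ml -surjective_pairing.
  by under eq_fun do rewrite Mr -surjective_pairing.
- by apply: pwedge2_ind => z; rewrite ?Ml ?Mr ?fu0 ?fv0.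
- by apply: pwedge2_ind => z; rewrite ?Ml ?Mr ?fu1 ?fv1.
- by move=> t; rewrite pwedge2_point Ml.
Qed.

Lemma pwedge2_map_wl (X Y X' Y' : ptopologicalType) (f : X -> X') (g : Y -> Y') :
  f point = point -> g point = point ->
  forall x, pwedge2_map f g (wl Y x) = wl Y' (f x).
Proof. by move=> f0 g0; have [] := pwedge2_mapE f0 g0. Qed.

Lemma pwedge2_map_wr (X Y X' Y' : ptopologicalType) (f : X -> X') (g : Y -> Y') :
  f point = point -> g point = point ->
  forall y, pwedge2_map f g (wr X y) = wr X' (g y).
Proof. by move=> f0 g0; have [] := pwedge2_mapE f0 g0. Qed.

Lemma pwedge2_map_pm (X Y X' Y' : ptopologicalType) (f : X -> X') (g : Y -> Y') :
  pointed_map f -> pointed_map g -> pointed_map (pwedge2_map f g).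
Proof.
move=> [cf f0] [cg g0]; have {}cf : cts f by []. have {}cg : cts g by [].
split; last by rewrite pwedge2_point pwedge2_map_wl// f0 -pwedge2_point.
apply: cts_wedge.
  apply: (@cts_ext _ _ _ (fun x => wl Y' (f x))); last by cts_auto.
  by move=> x; rewrite pwedge2_map_wl.
apply: (@cts_ext _ _ _ (fun y => wr X' (g y))); last by cts_auto.
by move=> y; rewrite pwedge2_map_wr.
Qed.

Lemma wl_pm (X Y : ptopologicalType) : pointed_map (@wl X Y).
Proof. by split; [exact: cts_wl|rewrite pwedge2_point]. Qed.

Lemma wr_pm (X Y : ptopologicalType) : pointed_map (@wr X Y).
Proof. by split; [exact: cts_wr|rewrite pwedge2_point wl_point]. Qed.

Let pwedge2_map_ph (X Y X' Y' : ptopologicalType) (f : X -> X') (g : Y -> Y')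
    (f' : X' -> X) (g' : Y' -> Y) :
  pointed_map f -> pointed_map g -> pointed_map f' -> pointed_map g' ->
  pointed_homotopic R (f' \o f) idfun -> pointed_homotopic R (g' \o g) idfun ->
  pointed_homotopic R (pwedge2_map f' g' \o pwedge2_map f g) idfun.
Proof.
move=> pf pg pf' pg' ff gg.
have wph := @wedge_ph X Y (pwedge2 X Y)
  (pwedge2_map f' g' \o pwedge2_map f g) idfun (@wl X Y \o (f' \o f))
  (@wl X Y \o idfun) (@wr X Y \o (g' \o g)) (@wr X Y \o idfun).
apply: wph => //=.
- by move=> x; rewrite !pwedge2_map_wl//; [case: pf'|case: pg'|case: pf|case: pg].
- by move=> x; rewrite !pwedge2_map_wr//; [case: pf'|case: pg'|case: pf|case: pg].
- apply: ph_comp => //; [exact: pm_comp|exact: wl_pm|].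
  by apply: ph_refl; exact: wl_pm.
- apply: ph_comp => //; [exact: pm_comp|exact: wr_pm|].
  by apply: ph_refl; exact: wr_pm.
Qed.

Lemma pwedge2_map_he (X Y X' Y' : ptopologicalType) (f : X -> X') (g : Y -> Y') :
  pointed_homotopy_equivalence R f -> pointed_homotopy_equivalence R g ->
  pointed_homotopy_equivalence R (pwedge2_map f g).
Proof.
move=> [pf [f' [pf' ff' f'f]]] [pg [g' [pg' gg' g'g]]].
split; first exact: pwedge2_map_pm.
exists (pwedge2_map f' g'); split; first exact: pwedge2_map_pm.
  exact: pwedge2_map_ph.
exact: pwedge2_map_ph.
Qed.

End wedge_homotopy.

(** * Splitting the pushout *)

(* The pushout of [A <- A x B -> C x B] with right map [(x, y) |-> (point, y)]
   is the join glued to [C x B] along its end [B]. As [B] contracts in the join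
   to the basepoint, through [(point, t, y)], gluing along it amounts to wedging
   with the cone on [{point} x B] attached to [C x B]. *)
Section splitting.
Variables (R : realType) (A B C : ptopologicalType).

Definition const_end (p : A * B) : (C * B)%type := (point, p.2).
Definition const_pushout := uh R (@fst A B) const_end.
Definition split_wedge : ptopologicalType := pwedge2 (ujoin R A B) (coned R C B).

Local Notation jX := (@uX R _ _ _ (@fst A B) (@snd A B)).
Local Notation jY := (@uY R _ _ _ (@fst A B) (@snd A B)).
Local Notation jZ := (@uZ R _ _ _ (@fst A B) (@snd A B)).
Local Notation kX := (@uX R _ _ _ (@cone_vertex B) (@cone_base C B)).
Local Notation kY := (@uY R _ _ _ (@cone_vertex B) (@cone_base C B)).
Local Notation kZ := (@uZ R _ _ _ (@cone_vertex B) (@cone_base C B)).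
Local Notation qX := (@uX R _ _ _ (@fst A B) const_end).
Local Notation qY := (@uY R _ _ _ (@fst A B) const_end).
Local Notation qZ := (@uZ R _ _ _ (@fst A B) const_end).
Local Notation Wl := (@wl (ujoin R A B) (coned R C B)).
Local Notation Wr := (@wr (ujoin R A B) (coned R C B)).

Definition split_join : ujoin R A B -> const_pushout :=
  uh_rec qY qX (fun y => qZ (point, y)).

Definition split_cone : coned R C B -> const_pushout :=
  uh_rec (fun=> qY point) (fun q => qX ((point, q.1), q.2)) qZ.

Definition split : split_wedge -> const_pushout :=
  wedge_rec split_join split_cone.

Let join0 p : qX (p, @itv0 R) = qY p.1. Proof. exact: uX0. Qed.
Let join1 p : qX (p, @itv1 R) = qZ (point, p.2). Proof. exact: uX1. Qed.
Let cone0 y : qX ((point, y), @itv0 R) = qY point. Proof. exact: uX0. Qed.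
Let cone1 y : qX ((point, y), @itv1 R) = qZ (cone_base C y). Proof. exact: uX1. Qed.

Let split_point : split_join point = split_cone point.
Proof. by rewrite /split_join /split_cone !uh_recY. Qed.

Let split_jY x : split (Wl (jY x)) = qY x.
Proof. by rewrite /split wedge_rec_wl// /split_join uh_recY. Qed.

Let split_jX q : split (Wl (jX q)) = qX q.
Proof. by rewrite /split wedge_rec_wl// /split_join uh_recX. Qed.

Let split_jZ y : split (Wl (jZ y)) = qZ (point, y).
Proof. by rewrite /split wedge_rec_wl// /split_join uh_recZ. Qed.

Let split_kY x : split (Wr (kY x)) = qY point.
Proof. by rewrite /split wedge_rec_wr// /split_cone uh_recY. Qed.

Let split_kX y t : split (Wr (kX (y, t))) = qX ((point, y), t).
Proof. by rewrite /split wedge_rec_wr// /split_cone uh_recX. Qed.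

Let split_kZ z : split (Wr (kZ z)) = qZ z.
Proof. by rewrite /split wedge_rec_wr// /split_cone uh_recZ. Qed.

Let split_pm : pointed_map split.
Proof.
split; last by rewrite pwedge2_point split_jY.
have cj : cts split_join by apply: cts_uh_rec => //; cts_auto.
have ck : cts split_cone by apply: cts_uh_rec => //; cts_auto.
apply: cts_wedge.
  by apply: (@cts_ext _ _ _ split_join) => // x; rewrite /split wedge_rec_wl.
by apply: (@cts_ext _ _ _ split_cone) => // x; rewrite /split wedge_rec_wr.
Qed.

(** A path of length 3 in the wedge: across the join from [x] to the end [B], back along
    [(point, -, y)] to the wedge point, then along the cone line of [y] to its base. *)
Let U (p : A * B * R) : split_wedge :=
  ifle p.2 1 (Wl (jX (p.1, clamp p.2)))
    (ifle p.2 2 (Wl (jX ((point, p.1.2), clamp (2 - p.2))))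
       (Wr (kX (p.1.2, clamp (p.2 - 2))))).

Let U12 x y : Wl (jX ((x, y), itv1)) = Wl (jX ((point, y), itv1)).
Proof. by rewrite !uX1. Qed.

Let U23 y : Wl (jX ((point, y), itv0)) = Wr (kX (y, itv0)).
Proof. by rewrite !uX0; exact: wl_point. Qed.

Let U1 p u : u <= 1 -> U (p, u) = Wl (jX (p, clamp u)).
Proof. by move=> u1; rewrite /U ifleT. Qed.

Let U2 x y u : 1 <= u -> u <= 2 ->
  U ((x, y), u) = Wl (jX ((point, y), clamp (2 - u))).
Proof.
move=> u1 u2; rewrite /U /= ifle_ge ?ifleT// => ->.
by rewrite clamp1 clamp_ge1 ?U12//; lra.
Qed.

Let U3 x y u : 2 <= u -> U ((x, y), u) = Wr (kX (y, clamp (u - 2))).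
Proof.
move=> u2; rewrite /U /= ifleF; last lra.
by rewrite ifle_ge// => ->; rewrite subrr clamp0 U23.
Qed.

Let cU : cts U.
Proof.
rewrite /U; cts_auto; first by move=> p /= ->; rewrite subrr clamp0 U23.
move=> [[x y] u] /= ->; rewrite ifleT; last lra.
by rewrite clamp1 clamp_ge1 ?U12//; lra.
Qed.

Definition unsplit : const_pushout -> split_wedge :=
  uh_rec (fun x => Wl (jY x)) (fun q => U (q.1, 3 * uval q.2))
    (fun z => Wr (kZ z)).

Let unsplit0 p : U (p, 3 * uval (@itv0 R)) = Wl (jY p.1).
Proof. by rewrite uval0 mulr0 U1// clamp0 uX0. Qed.

Let unsplit1 p : U (p, 3 * uval (@itv1 R)) = Wr (kZ (const_end p)).
Proof.
case: p => x y; rewrite uval1 mulr1 U3; last lra.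
by rewrite clamp_ge1 ?uX1//; lra.
Qed.

Let unsplitY x : unsplit (qY x) = Wl (jY x). Proof. exact: uh_recY. Qed.

Let unsplitX p t : unsplit (qX (p, t)) = U (p, 3 * uval t).
Proof. exact: uh_recX. Qed.

Let unsplitZ z : unsplit (qZ z) = Wr (kZ z). Proof. exact: uh_recZ. Qed.

Let unsplit_pm : pointed_map unsplit.
Proof.
split; last by rewrite -[point]/(qY point) unsplitY pwedge2_point.
by apply: cts_uh_rec => //; cts_auto.
Qed.

Let splitK : pointed_homotopic R (split \o unsplit) idfun.
Proof.
pose V (p : A * B * R) : const_pushout :=
  ifle p.2 1 (qX (p.1, clamp p.2)) (qX ((point, p.1.2), clamp (2 - p.2))).
have V12 x y : qX ((x, y), @itv1 R) = qX ((point, y), itv1) by rewrite !uX1.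
have V1 p u : u <= 1 -> V (p, u) = qX (p, clamp u) by move=> ?; rewrite /V ifleT.
have V2 x y u : 1 <= u -> V ((x, y), u) = qX ((point, y), clamp (2 - u)).
  move=> u1; rewrite /V /= ifle_ge// => ->.
  by rewrite clamp1 clamp_ge1 ?V12//; lra.
have cV : cts V.
  rewrite /V; cts_auto => -[[x y] u] /= ->.
  by rewrite clamp1 clamp_ge1 ?V12//; lra.
(* After [split], the last two pieces of [U] run along [(point, -, y)] forth and back. As a
   parameter of [V] this is a climb to 2 at [t = 2/3] and a return to 1. *)
pose al (t : R) := Num.min (3 * t) (4 - 3 * t).
apply: (@uh_ph R _ _ _ (@fst A B) const_end _ _ _ (fun p => qY p.1)
  (fun p => V (p.1.1, (1 - uval p.2) * al (uval p.1.2) + uval p.2 * uval p.1.2))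
  (fun p => qZ p.1)) => //=.
- move=> p s; rewrite uval0 /al !mulr0 subr0 min_l ?ler0n// mulr0 addr0.
  by rewrite V1// clamp0 uX0.
- move=> p s; rewrite uval1 /al min_r; last lra.
  by rewrite (_ : _ + _ = 1); [rewrite V1// clamp1 uX1|lra].
- by cts_auto.
- by rewrite /al; cts_auto.
- by cts_auto.
- by move=> x; rewrite unsplitY split_jY.
- move=> [x y] t; rewrite uval0 subr0 mul1r mul0r addr0 unsplitX.
  have t0 := uval_ge0 t; have t1 := uval_le1 t.
  have [t3|t3] := leP (3 * uval t) 1.
    by rewrite U1// split_jX /al min_l ?V1//; lra.
  have [t3'|t3'] := leP (3 * uval t) 2.
    by rewrite U2 ?split_jX /al ?min_l ?V2//; lra.
  rewrite U3; last lra.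
  rewrite split_kX /al min_r; last lra.
  rewrite V2; last lra.
  by congr (qX (_, clamp _)); lra.
- move=> p t; rewrite uval1 subrr mul0r add0r mul1r V1 ?clampK//.
  exact: uval_le1.
- by move=> z; rewrite unsplitZ split_kZ.
Qed.

(** The path [U] is shortened from length 3 to length 1. Its end moves meanwhile, and the end [B] of
    the join can follow because from [u = 1] on [U] depends on [y] only. *)
Let unsplitK_join :
  pointed_homotopic R (fun w => unsplit (split (Wl w))) (fun w => Wl w).
Proof.
apply: (@uh_ph R _ _ _ (@fst A B) snd _ _ _ (fun p => Wl (jY p.1))
  (fun p => U (p.1.1, (3 - 2 * uval p.2) * uval p.1.2))
  (fun p => U ((point, p.1), 3 - 2 * uval p.2))) => //=.
- by move=> p s; rewrite uval0 mulr0 U1// clamp0 uX0.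
- move=> [x y] s; rewrite uval1 mulr1.
  have s0 := uval_ge0 s; have s1 := uval_le1 s.
  by have [s2|s2] := leP (3 - 2 * uval s) 2; [rewrite !U2//; lra|rewrite !U3//; lra].
- by cts_auto.
- by cts_auto.
- by cts_auto.
- by move=> x; rewrite split_jY unsplitY.
- by move=> p t; rewrite split_jX unsplitX uval0 mulr0 subr0.
- move=> p t; rewrite uval1 mulr1 (_ : 3 - 2 = 1); last lra.
  by rewrite mul1r U1 ?uval_le1// clampK.
- move=> y; rewrite split_jZ unsplitZ uval0 mulr0 subr0 U3; last lra.
  by rewrite clamp_ge1 ?uX1//; lra.
- move=> y; rewrite uval1 mulr1 (_ : 3 - 2 = 1); last lra.
  by rewrite U1// clamp1 uX1.
- by move=> _; rewrite pwedge2_point.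
Qed.

Let unsplitK_cone :
  pointed_homotopic R (fun w => unsplit (split (Wr w))) (fun w => Wr w).
Proof.
pose V (p : B * R) : split_wedge :=
  ifle p.2 0 (Wl (jX ((point, p.1), clamp (- p.2)))) (Wr (kX (p.1, clamp p.2))).
have V1 y u : u <= 0 -> V (y, u) = Wl (jX ((point, y), clamp (- u))).
  by move=> u0; rewrite /V ifleT.
have V2 y u : 0 <= u -> V (y, u) = Wr (kX (y, clamp u)).
  by move=> u0; rewrite /V ifle_ge//= => ->; rewrite oppr0 clamp0 U23.
have cV : cts V.
  by rewrite /V; cts_auto => p /= ->; rewrite oppr0 clamp0 U23.
(* Over the cone line of [y], [unsplit \o split] makes an excursion into the join and back before
   following the cone. Counting the join side negatively, the parameter falls to -1 at [t = 1/3] and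
   then rises to 1. *)
pose al (t : R) := Num.max (- (3 * t)) (3 * t - 2).
apply: (@uh_ph R _ _ _ (@cone_vertex B) (@cone_base C B) _ _ _
  (fun p => Wr (kY p.1))
  (fun p => V (p.1.1, (1 - uval p.2) * al (uval p.1.2) + uval p.2 * uval p.1.2))
  (fun p => Wr (kZ p.1))) => //=.
- move=> y s; rewrite uval0 /al !mulr0 oppr0 max_l; last lra.
  by rewrite mulr0 addr0 V2// clamp0 uX0.
- move=> y s; rewrite uval1 /al max_r; last lra.
  by rewrite (_ : _ + _ = 1); [rewrite V2// clamp1 uX1|lra].
- by cts_auto.
- by rewrite /al; cts_auto.
- by cts_auto.
- by move=> x; rewrite split_kY unsplitY (one_pointE x) -wl_point.
- move=> y t; rewrite split_kX unsplitX uval0 subr0 mul1r mul0r addr0.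
  have t0 := uval_ge0 t; have t1 := uval_le1 t.
  have [t3|t3] := leP (3 * uval t) 1.
    by rewrite U1// /al max_l ?V1 ?opprK//; lra.
  have [t3'|t3'] := leP (3 * uval t) 2.
    by rewrite U2 /al ?max_r ?V1 ?opprB//; lra.
  by rewrite U3 /al ?max_r ?V2//; lra.
- move=> y t; rewrite uval1 subrr mul0r add0r mul1r V2 ?clampK//.
  exact: uval_ge0.
- by move=> z; rewrite split_kZ unsplitZ.
Qed.

Lemma split_he : pointed_homotopy_equivalence R split.
Proof.
split; first exact: split_pm.
exists unsplit; split; [exact: unsplit_pm| |exact: splitK].
exact: (@wedge_ph R (ujoin R A B) (coned R C B) split_wedge (unsplit \o split)
  idfun (fun w => unsplit (split (Wl w))) (fun w => Wl w)
  (fun w => unsplit (split (Wr w))) (fun w => Wr w)).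
Qed.

Lemma split_wlY x : split (Wl (jY x)) = qY x. Proof. exact: split_jY. Qed.
Lemma split_wlX q : split (Wl (jX q)) = qX q. Proof. exact: split_jX. Qed.
Lemma split_wlZ y : split (Wl (jZ y)) = qZ (point, y).
Proof. exact: split_jZ. Qed.
Lemma split_wrY x : split (Wr (kY x)) = qY point. Proof. exact: split_kY. Qed.
Lemma split_wrX y t : split (Wr (kX (y, t))) = qX ((point, y), t).
Proof. exact: split_kX. Qed.
Lemma split_wrZ z : split (Wr (kZ z)) = qZ z. Proof. exact: split_kZ. Qed.

End splitting.

(** * Nondegenerate points of CW complexes *)

Lemma cts_cluster (T U : topologicalType) (f : T -> U) (p q : T) :
  cts f -> hausdorff_space U -> cluster (nbhs p) q -> f p = f q.
Proof.
move=> cf hU pq; apply: hU => A B Af Bf.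
have [z [? ?]] := pq _ _ (cf p A Af) (cf q B Bf).
by exists (f z).
Qed.

Lemma hausdorff_prod_itv (R : realType) (X : topologicalType) :
  hausdorff_space X -> hausdorff_space (X * unit_itv R)%type.
Proof.
move=> hX [x s] [y t] c.
have cf : cts (fun p : X * unit_itv R => p.1) by cts_auto.
have cs : cts (fun p : X * unit_itv R => uval p.2) by cts_auto.
have /= -> := cts_cluster cf hX c.
by have /= /uval_inj -> := cts_cluster cs (@Rhausdorff R) c.
Qed.

Lemma cts_subset (T : topologicalType) (A : set T) :
  cts (set_val : set_type A -> T).
Proof. exact: initial_continuous. Qed.

Lemma cts_to_subset (T U : topologicalType) (A : set U) (f : T -> set_type A) :
  cts (fun x => set_val (f x)) -> cts f.
Proof. by move=> cf; apply/continuous_comp_initial. Qed.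

(** For pieces whose formula is continuous only on the piece itself: the radial projection used
    below breaks down at the centre of the disc. *)
Lemma cts_glue_subset (T U : topologicalType) (A B : set T) (h : T -> U) :
  closed A -> closed B -> (forall x, A x \/ B x) ->
  cts (fun x : set_type A => h (set_val x)) ->
  cts (fun x : set_type B => h (set_val x)) -> cts h.
Proof.
move=> cA cB AB hA hB; apply/continuous_closedP => E cE.
have clp (D : set T) : closed D -> cts (fun x : set_type D => h (set_val x)) ->
    closed (D `&` h @^-1` E).
  move=> cD /continuous_closedP/(_ E cE); rewrite /closed => clE x clx.
  have Dx : D x by apply: cD => V /clx [y [[]]]; exists y.
  split=> //=; pose x' : set_type D := exist _ x (mem_set Dx).
  suff /(clE x') : closure ((fun x : set_type D => h (set_val x)) @^-1` E) x' by [].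
  move=> V [_ [[W oW <-] Wx WV]].
  have [y [[Dy Ey] Wy]] : (D `&` h @^-1` E) `&` W !=set0.
    by apply: clx; apply: open_nbhs_nbhs; split.
  exists (exist _ y (mem_set Dy)); split => //; exact: WV.
rewrite (_ : _ @^-1` _ = (A `&` h @^-1` E) `|` (B `&` h @^-1` E)).
  by apply: closedU; exact: clp.
apply/seteqP; split=> x /=; last by case=> -[].
by case: (AB x); [left|right].
Qed.

(** * Discs and spheres in Euclidean space *)

Section euclidean.
Variables (R : realType) (n : nat).
Implicit Types v : 'rV[R]_n.

Lemma cts_sqnorm : cts (@sqnorm R n).
Proof.
rewrite /sqnorm; elim: (index_enum _) => [|i s IHs].
  by apply: (@cts_ext _ _ _ (fun=> 0)) => [v|]; rewrite ?big_nil//; exact: cts_cst.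
apply: (@cts_ext _ _ _ (fun v => v ord0 i * v ord0 i + \sum_(j <- s) v ord0 j ^+ 2)).
  by move=> v; rewrite big_cons expr2.
have ci : cts (fun v => v ord0 i) by exact: coord_continuous.
by apply: cts_add => //; exact: cts_mul.
Qed.

Lemma sqnorm_ge0 v : 0 <= sqnorm v.
Proof. by apply: sumr_ge0 => i _; exact: sqr_ge0. Qed.

Lemma sqnormZ a v : sqnorm (a *: v) = a ^+ 2 * sqnorm v.
Proof.
by rewrite /sqnorm big_distrr; apply: eq_bigr => i _; rewrite mxE exprMn.
Qed.

Definition enorm v : R := Num.sqrt (sqnorm v).

Lemma cts_enorm : cts enorm.
Proof. by apply: cts_comp cts_sqnorm; exact: sqrt_continuous. Qed.

Lemma enorm_ge0 v : 0 <= enorm v.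
Proof. exact: sqrtr_ge0. Qed.

Lemma enormZ a v : 0 <= a -> enorm (a *: v) = a * enorm v.
Proof.
by move=> a0; rewrite /enorm sqnormZ sqrtrM ?sqr_ge0// sqrtr_sqr ger0_norm.
Qed.

Lemma discE v : disc R n v <-> enorm v <= 1.
Proof. by rewrite /enorm -[1]sqrtr1 ler_sqrt. Qed.

Lemma open_discE v : open_disc R n v <-> enorm v < 1.
Proof. by rewrite /enorm -[1]sqrtr1 ltr_sqrt. Qed.

Lemma sphereE v : sphere R n v <-> enorm v = 1.
Proof.
rewrite /enorm; split=> [->|e1]; first by rewrite sqrtr1.
by rewrite /sphere /= -(sqr_sqrtr (sqnorm_ge0 v)) e1 expr1n.
Qed.

Lemma cts_scale (T : topologicalType) (a : T -> R) (f : T -> 'rV[R]_n) :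
  cts a -> cts f -> cts (fun x => a x *: f x).
Proof. by move=> ca cf x; apply: cvgZ; [exact: ca|exact: cf]. Qed.

Lemma cts_addv (T : topologicalType) (f g : T -> 'rV[R]_n) :
  cts f -> cts g -> cts (fun x => f x + g x).
Proof. by move=> cf cg x; apply: cvgD; [exact: cf|exact: cg]. Qed.

Lemma cts_oppv (T : topologicalType) (f : T -> 'rV[R]_n) :
  cts f -> cts (fun x => - f x).
Proof. by move=> cf x; apply: cvgN; exact: cf. Qed.

Lemma cts_inv (T : topologicalType) (a : T -> R) :
  (forall x, a x != 0) -> cts a -> cts (fun x => (a x)^-1).
Proof. by move=> a0 ca x; apply: cvgV => //; exact: ca. Qed.

(** The radial retraction onto the disc. Composed with it, a characteristic map, of which only the
    values on the disc matter, becomes continuous on the whole space. *)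
Definition to_disc v := (Num.max 1 (enorm v))^-1 *: v.

Lemma to_disc_id v : enorm v <= 1 -> to_disc v = v.
Proof. by move=> v1; rewrite /to_disc max_l// invr1 scale1r. Qed.

Let max_gt0 v : 0 < Num.max 1 (enorm v).
Proof. by rewrite lt_max ltr01. Qed.

Lemma to_disc_le1 v : enorm (to_disc v) <= 1.
Proof.
rewrite /to_disc enormZ ?invr_ge0 ?(ltW (max_gt0 v))//.
by rewrite ler_pdivrMl// mulr1 le_max lexx orbT.
Qed.

Lemma cts_to_disc : cts to_disc.
Proof.
apply: cts_scale; last exact: cts_id.
apply: cts_inv; first by move=> v; rewrite gt_eqF.
by apply: cts_max; [exact: cts_cst|exact: cts_enorm].
Qed.

Lemma closed_disc : closed (disc R n).
Proof. by apply: closed_le_fun; [exact: cts_sqnorm|exact: cts_cst]. Qed.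

Lemma coord_le_disc v i : disc R n v -> `|v ord0 i| <= 1.
Proof.
rewrite /disc /= /sqnorm (bigD1 i)//= => v1.
have : v ord0 i ^+ 2 <= 1.
  by apply: le_trans v1; rewrite lerDl; apply: sumr_ge0 => j _; exact: sqr_ge0.
by rewrite -real_normK ?num_real// expr_le1.
Qed.

Lemma compact_disc : compact (disc R n).
Proof.
apply: bounded_closed_compact; last exact: closed_disc.
exists 1; split; first exact: num_real.
move=> M M1 v vD; rewrite /= [leLHS]mx_normrE.
apply/bigmax_leP; split=> [|[i j] _ /=]; first by rewrite (le_trans _ (ltW M1)).
by rewrite (ord1 i) (le_trans (coord_le_disc j vD))// ltW.
Qed.

Lemma open_open_disc : open (open_disc R n).
Proof.
rewrite (_ : open_disc R n = ~` [set v | 1 <= sqnorm v]).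
  by apply: closed_openC; apply: closed_le_fun; [exact: cts_cst|exact: cts_sqnorm].
by apply/seteqP; split=> v; rewrite /open_disc /= ltNge => /negP.
Qed.

End euclidean.

(** * Contracting a neighbourhood of a point, cell by cell *)

Section cw_well_pointed.
Variables (R : realType) (X : topologicalType) (S : cw_structure R X).
Hypothesis hX : hausdorff_space X.

Local Notation phi := (@char_map R X S).
Local Notation dimc := (@Defs.dim R X S).

Definition char_disc (c : cell S) (v : 'rV[R]_(dimc c)) : X := phi (to_disc v).
Local Notation phid := char_disc.

Lemma char_discE c (v : 'rV[R]_(dimc c)) : enorm v <= 1 -> phid v = phi v.
Proof. by move=> v1; rewrite /phid to_disc_id. Qed.

Lemma cts_char_disc c : cts (@char_disc c).
Proof.
have to_discP v : to_disc v \in disc R (dimc c).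
  by apply/mem_set/discE; exact: to_disc_le1.
pose r v : set_type (disc R (dimc c)) := exist _ (to_disc v) (to_discP v).
have cr : cts r by apply: cts_to_subset; exact: cts_to_disc.
have cp : cts (sigL (disc R (dimc c)) (phi (c := c))).
  exact/subspace_sigL_continuousP/char_map_continuous.
exact: (cts_comp cp cr).
Qed.

Lemma cell_ofP (x : X) : exists cu : {c : cell S & 'rV[R]_(dimc c)},
  enorm (projT2 cu) < 1 /\ phi (projT2 cu) = x.
Proof.
have : [set: X] x by [].
rewrite -(open_cells_cover S) => -[c _ [u /open_discE u1 ux]].
by exists (existT _ c u).
Qed.

(** The open cell through [x] and the coordinate of [x] in it. Disjointness of the cells and
    injectivity on them make the choice unique, see [cell_of_char]. *)
Definition cell_of x := projT1 (cid (cell_ofP x)).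
Definition cell_dim x := dimc (projT1 (cell_of x)).

Lemma cell_of1 x : enorm (projT2 (cell_of x)) < 1.
Proof. by rewrite /cell_of; case: cid => ? []. Qed.

Lemma cell_ofK x : phi (projT2 (cell_of x)) = x.
Proof. by rewrite /cell_of; case: cid => ? []. Qed.

Lemma open_cell_eq c d (u : 'rV[R]_(dimc c)) (v : 'rV[R]_(dimc d)) :
  enorm u < 1 -> enorm v < 1 -> phi u = phi v -> c = d.
Proof.
move=> u1 v1 uv; apply: (@open_cells_disjoint _ _ S c d) => //.
exists (phi u); split; first by exists u => //; exact/open_discE.
by rewrite uv; exists v => //; exact/open_discE.
Qed.

Lemma open_cell_inj c (u v : 'rV[R]_(dimc c)) :
  enorm u < 1 -> enorm v < 1 -> phi u = phi v -> u = v.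
Proof.
by move=> u1 v1; apply: char_map_inj; apply/mem_set/open_discE.
Qed.

Lemma cell_of_char c (u : 'rV[R]_(dimc c)) :
  enorm u < 1 -> cell_of (phi u) = existT _ c u.
Proof.
move=> u1; have := cell_of1 (phi u); have := cell_ofK (phi u).
case: (cell_of _) => d v /= vu v1.
have dc := open_cell_eq v1 u1 vu; subst d.
by congr existT; exact: open_cell_inj.
Qed.

Lemma cell_dim_char c (u : 'rV[R]_(dimc c)) :
  enorm u < 1 -> cell_dim (phi u) = dimc c.
Proof. by move=> u1; rewrite /cell_dim cell_of_char. Qed.

(** This is what makes recursion on [cell_dim] possible: pushing a point onto the boundary of its
    cell lowers the dimension. *)
Lemma cell_dim_sphere c (v : 'rV[R]_(dimc c)) :
  enorm v = 1 -> (cell_dim (phi v) < dimc c)%N.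
Proof.
move=> /sphereE vS; have [s [_ sd sv]] := @closure_finite _ _ S c.
have [d sdd [u /open_discE u1 <-]] := sv _ (ex_intro2 _ _ v vS erefl).
by rewrite cell_dim_char//; exact: sd.
Qed.

Lemma char_disc_final : final_family char_disc.
Proof.
split=> [x|U oU].
  exists (projT1 (cell_of x)), (projT2 (cell_of x)).
  by rewrite char_discE ?cell_ofK// ltW// cell_of1.
rewrite -[U]setCK; apply: closed_openC; apply/(weak_topology S) => c.
rewrite (_ : _ `&` _ = disc R (dimc c) `&` ~` (char_disc (c := c) @^-1` U)).
  by apply: closedI; [exact: closed_disc|exact: open_closedC].
by apply/seteqP; split=> v [vD]; move/discE: (vD) => v1 /=; rewrite char_discE.
Qed.

(* The sphere is mapped into finitely many closed cells of lower dimension,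
   which are compact. *)
Lemma cts_sphere (Z : topologicalType) (G : X * unit_itv R -> Z) c :
  (forall d, (dimc d < dimc c)%N ->
    cts (fun p : 'rV[R]_(dimc d) * unit_itv R => G (phid p.1, p.2))) ->
  cts (fun p : set_type (sphere R (dimc c)) * unit_itv R =>
         G (phi (set_val p.1), p.2)).
Proof.
move=> Gd; apply/continuous_closedP => E cE.
have [s [fs sd sv]] := @closure_finite _ _ S c.
(* The part of [E] over each of these closed cells is compact, so its image in the Hausdorff space
   [X * unit_itv R] is closed; the finite union of the images cuts out the preimage of [E] over the
   sphere. *)
pose P d := (disc R (dimc d) `*` [set: unit_itv R]) `&`
  (fun p : 'rV[R]_(dimc d) * unit_itv R => G (phid p.1, p.2)) @^-1` E.
pose Q d := (fun p : 'rV[R]_(dimc d) * unit_itv R => (phid p.1, p.2)) @` P d.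
have cQ : closed (\bigcup_(d in s) Q d).
  apply: (@closed_bigcup _ {classic cell S}) => // d sdd.
  apply: compact_closed; first exact: hausdorff_prod_itv.
  apply: continuous_compact.
    have cd := @cts_char_disc d.
    apply: continuous_subspaceT.
    change (cts (fun p : 'rV[R]_(dimc d) * unit_itv R => (phid p.1, p.2))).
    by cts_auto.
  apply: compact_closedI.
    by apply: compact_setX; [exact: compact_disc|exact: itv_compact].
  by have /continuous_closedP := Gd d (sd d sdd); apply.
have sP (v : set_type (sphere R (dimc c))) : sphere R (dimc c) (set_val v).
  by case: v => v vS; exact: set_mem vS.
pose F (p : set_type (sphere R (dimc c)) * unit_itv R) : X * unit_itv R :=
  (phid (c := c) (set_val p.1), p.2).
have cF : cts F.
  have cd := @cts_char_disc c; have cv := @cts_subset _ (sphere R (dimc c)).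
  by rewrite /F; cts_auto.
have FE p : F p = (phi (set_val p.1), p.2).
  by rewrite /F char_discE//; have /sphereE -> := sP p.1.
rewrite (_ : _ @^-1` _ = F @^-1` (\bigcup_(d in s) Q d)).
  by move/continuous_closedP: cF; apply.
apply/seteqP; split=> [[v t]|[v t] [d sdd [[u t'] [_ /= Eu]]]] /=; last first.
  by rewrite FE => -[<- <-].
move=> Ev; rewrite FE /=.
have [d sdd [u /open_discE u1 uv]] := sv _ (ex_intro2 _ _ _ (sP v) erefl).
exists d => //; exists (u, t); last by rewrite char_discE ?uv// ltW.
split; first by split=> //; apply/discE; exact: ltW.
by rewrite /= char_discE ?uv// ltW.
Qed.

Variables (c0 : cell S) (v0 : 'rV[R]_(dimc c0)) (eps : R).
Hypothesis eps0 : 0 < eps.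
Hypothesis v0eps : forall v, `|v - v0| < eps -> enorm v < 1.

Let v01 : enorm v0 < 1.
Proof. by apply: v0eps; rewrite subrr normr0. Qed.

(** Distance to [v0] in units of [eps], for the norm of the matrix space. The deformation [bump]
    contracts the ball [q <= 1/2] linearly to [v0] and fixes every point with [1 <= q], in
    particular the boundary of the disc; [lam] is positive exactly for [q < 1/2]. *)
Let q (v : 'rV[R]_(dimc c0)) : R := `|v - v0| / eps.
Let kap v := uval (clamp (2 - 2 * q v)).
Let bump (v : 'rV[R]_(dimc c0)) (t : unit_itv R) : 'rV[R]_(dimc c0) :=
  v - (uval t * kap v) *: (v - v0).
Let lam v := Num.max 0 (1 - 2 * q v).

Let cq : cts q.
Proof.
have cn : cts (fun v : 'rV[R]_(dimc c0) => `|v|) by exact: norm_continuous.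
apply: cts_mul; last exact: cts_cst.
have cs : cts (fun v : 'rV[R]_(dimc c0) => v - v0).
  by apply: cts_addv; [exact: cts_id|exact: cts_cst].
exact: (cts_comp cn cs).
Qed.

Let clam : cts lam. Proof. by rewrite /lam; cts_auto. Qed.

Let cbump : cts (fun p : 'rV[R]_(dimc c0) * unit_itv R => bump p.1 p.2).
Proof.
have c1 : cts (fun p : 'rV[R]_(dimc c0) * unit_itv R => p.1) by cts_auto.
apply: (cts_addv c1).
apply: cts_oppv; apply: cts_scale; first by rewrite /kap; cts_auto.
by apply: (cts_addv c1); exact: cts_cst.
Qed.

Let q0 : q v0 = 0. Proof. by rewrite /q subrr normr0 mul0r. Qed.

Let q_ge1 v : 1 <= enorm v -> 1 <= q v.
Proof.
move=> v1; rewrite /q ler_pdivlMr// mul1r leNgt; apply/negP => /v0eps.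
by rewrite ltNge v1.
Qed.

Let bump0 v : bump v itv0 = v.
Proof. by rewrite /bump uval0 mul0r scale0r subr0. Qed.

Let bump_v0 t : bump v0 t = v0.
Proof. by rewrite /bump subrr scaler0 subr0. Qed.

Let bump_out v t : 1 <= q v -> bump v t = v.
Proof.
move=> q1; rewrite /bump /kap clamp_le0; last lra.
by rewrite uval0 mulr0 scale0r subr0.
Qed.

Let bump1 v : 0 < lam v -> bump v itv1 = v0.
Proof.
rewrite /lam lt_max ltxx /= => l0; rewrite /bump /kap clamp_ge1; last lra.
by rewrite !uval1 mulr1 scale1r subKr.
Qed.

(** The track of a point under the deformation, together with the value of the function that is to
    detect the contracted neighbourhood; both are extended over the cells by one recursion. *)
Let data : Type := ((unit_itv R -> X) * R)%type.

Let inv0 x := xget v0 [set v | enorm v < 1 /\ phi v = x].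

(** The other cells of dimension at most that of [c0] stay fixed. This fits with [c0], on whose
    boundary sphere [bump] is the identity and [lam] vanishes. *)
Let base (x : X) : data :=
  if `[< projT1 (cell_of x) = c0 >]
  then (fun t => phid (bump (inv0 x) t), lam (inv0 x)) else (fun=> x, 0).

(* On a cell attached above [c0], a point of norm [r] is pushed away from the
   centre until it reaches the sphere, and then follows the deformation of the
   attaching sphere. At time 1 this deformation is completed for [2 / 3 <= r]. *)
Let step c (k : X -> data) (u : 'rV[R]_(dimc c)) : data :=
  let r := enorm u in let y := phi (r^-1 *: u) in
  (fun t => ifle ((1 + 2 * uval t) * r) 1 (phid ((1 + 2 * uval t) *: u))
      ((k y).1 (clamp (Num.min (uval t) ((1 + 2 * uval t) * r - 1)))),
   Num.max 0 (3 * r - 2) * (k y).2).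

(** [k] bounds the dimension of the cell of [x]; by [cw_deform_recE] any bound gives the same
    result. *)
Fixpoint cw_deform_rec (k : nat) (x : X) : data :=
  if k isn't k'.+1 then base x else
  if (cell_dim x <= dimc c0)%N then base x
  else step (cw_deform_rec k') (projT2 (cell_of x)).

Definition cw_deform x := cw_deform_rec (cell_dim x) x.
Local Notation K := cw_deform.

(** At the centre the inverse of the radius is 0 by convention, and the projected point is
    meaningless. Neither component sees it: the test selects the first branch at all times, and the
    factor [Num.max 0 (3 * r - 2)] is 0. *)
Let step_ext c (k k' : X -> data) (u : 'rV[R]_(dimc c)) :
  (enorm u != 0 -> k (phi ((enorm u)^-1 *: u)) = k' (phi ((enorm u)^-1 *: u))) ->
  step k u = step k' u.
Proof.
rewrite /step => kk'; have [u0|u0] := eqVneq (enorm u) 0; last by rewrite kk'.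
congr pair; last by rewrite u0 mulr0 max_l ?mul0r//; lra.
by apply/funext => t; rewrite !ifleT// u0 mulr0.
Qed.

Let enorm_normalize c (u : 'rV[R]_(dimc c)) :
  enorm u != 0 -> enorm ((enorm u)^-1 *: u) = 1.
Proof. by move=> u0; rewrite enormZ ?invr_ge0 ?enorm_ge0// mulVf. Qed.

Let cw_deform_recE k k' x : (cell_dim x <= k)%N -> (cell_dim x <= k')%N ->
  cw_deform_rec k x = cw_deform_rec k' x.
Proof.
elim: k k' x => [|k IHk] [|k'] x //= xk xk'.
- by rewrite (leq_trans xk).
- by rewrite (leq_trans xk').
case: ifPn => // _; apply: step_ext => /enorm_normalize/cell_dim_sphere ux.
by apply: IHk; rewrite -ltnS; exact: leq_trans xk || exact: leq_trans xk'.
Qed.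

Let K_step c (u : 'rV[R]_(dimc c)) : enorm u < 1 -> (dimc c0 < dimc c)%N ->
  K (phi u) = step K u.
Proof.
move=> u1 c0c; rewrite /K cell_dim_char//.
case: (dimc c) (cell_dim_char u1) c0c => // k uk c0c.
rewrite /= uk leqNgt c0c /= cell_of_char//=.
apply: step_ext => /enorm_normalize/cell_dim_sphere ux.
by apply: cw_deform_recE => //; rewrite -ltnS -uk (cell_dim_char u1).
Qed.

Let K_base x : (cell_dim x <= dimc c0)%N -> K x = base x.
Proof. by rewrite /K; case E: (cell_dim x) => [|k] //= xk; rewrite E xk. Qed.

Let K_c0 (u : 'rV[R]_(dimc c0)) : enorm u < 1 ->
  K (phi u) = (fun t => phid (bump u t), lam u).
Proof.
move=> u1; rewrite K_base ?cell_dim_char// /base cell_of_char//= asboolT//.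
suff -> : inv0 (phi u) = u by [].
rewrite /inv0; case: xgetP => [v _ [v1 vu]|/(_ u)]; last by case.
exact: open_cell_inj vu.
Qed.

Let K_id c (u : 'rV[R]_(dimc c)) : enorm u < 1 -> (dimc c <= dimc c0)%N ->
  c <> c0 -> K (phi u) = (fun=> phi u, 0).
Proof.
move=> u1 cc0 cNc0; rewrite K_base ?cell_dim_char// /base cell_of_char//=.
by rewrite asboolF.
Qed.

Let K_id' x : (cell_dim x < dimc c0)%N -> K x = (fun=> x, 0).
Proof.
move=> xc0; have := K_id (cell_of1 x) (ltnW xc0); rewrite cell_ofK; apply=> E.
by move: xc0; rewrite /cell_dim E ltnn.
Qed.

Let K0 x : (K x).1 itv0 = x.
Proof.
rewrite -(cell_ofK x); move: (cell_of1 x); case: (cell_of x) => c u /= u1.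
have [cc0|c0c] := leqP (dimc c) (dimc c0); last first.
  rewrite K_step//= uval0 mulr0 addr0 mul1r ifleT ?scale1r ?ltW//.
  by rewrite char_discE// ltW.
have [E|cNc0] := pselect (c = c0); last by rewrite K_id.
by subst c; rewrite K_c0//= bump0 char_discE// ltW.
Qed.

(** For [r = 1] the time [(1 + 2t) r - 1 = 2t] is cut down to [t] by the minimum, and the factor
    [3 * r - 2] is 1. Hence the formula for the interior of the cell also holds on its boundary,
    where continuity could fail. *)
Let K_sphere_step c (u : 'rV[R]_(dimc c)) : enorm u = 1 -> K (phi u) = step K u.
Proof.
move=> u1; rewrite /step u1 invr1 scale1r mulr1 [LHS]surjective_pairing.
have -> : 3 - 2 = 1 :> R by lra.
rewrite max_r// mul1r; apply: (f_equal2 pair) => //.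
apply/funext => t; have t0 := uval_ge0 t; rewrite mulr1.
rewrite ifle_ge; [|move=> t1|lra].
  by rewrite min_l ?clampK//; lra.
rewrite t1 subrr scale1r char_discE ?u1// min_r// clamp0.
by rewrite K0.
Qed.

Let K_v0 t : (K (phi v0)).1 t = phi v0.
Proof. by rewrite K_c0//= bump_v0 char_discE// ltW. Qed.

Let K_lam : (K (phi v0)).2 = 1.
Proof. by rewrite K_c0//= /lam q0 mulr0 subr0 max_r. Qed.

Let K1 x : 0 < (K x).2 -> (K x).1 itv1 = phi v0.
Proof.
move: {2}(cell_dim x) (leqnn (cell_dim x)) => k.
elim: k x => [|k IHk] x; rewrite -(cell_ofK x); move: (cell_of1 x);
  case: (cell_of x) => c u /= u1; rewrite cell_dim_char// => ck.
- have [E|cNc0] := pselect (c = c0).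
    by subst c; rewrite K_c0//= => l0; rewrite bump1// char_discE// ltW.
  by rewrite K_id//= ?ltxx// (leq_trans ck).
have [cc0|c0c] := leqP (dimc c) (dimc c0).
  have [E|cNc0] := pselect (c = c0); last by rewrite K_id//= ltxx.
  by subst c; rewrite K_c0//= => l0; rewrite bump1// char_discE// ltW.
rewrite K_step//=; have [r0|r0] := leP (3 * enorm u - 2) 0.
  by rewrite mul0r ltxx.
rewrite pmulr_rgt0// => l0.
rewrite uval1 ifleF; last lra.
rewrite min_l; last lra.
rewrite clamp1 IHk// -ltnS (leq_trans _ ck)//.
apply: cell_dim_sphere; apply: enorm_normalize; rewrite gt_eqF//; lra.
Qed.

Let K_cts_base c : (dimc c <= dimc c0)%N ->
  cts (fun p : 'rV[R]_(dimc c) * unit_itv R => (K (phid p.1)).1 p.2) /\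
  cts (fun v : 'rV[R]_(dimc c) => (K (phid v)).2).
Proof.
move=> cc0; have cd := @cts_char_disc c; have ct := @cts_to_disc R (dimc c).
have [E|cNc0] := pselect (c = c0).
  subst c.
  have KE v : K (phid v) = (fun t => phid (bump (to_disc v) t), lam (to_disc v)).
    have := to_disc_le1 v; rewrite /phid; move: (to_disc v) => u.
    rewrite le_eqVlt => /orP[/eqP u1|u1]; last first.
      by rewrite K_c0//; congr pair; apply/funext => t; rewrite to_disc_id.
    have q1 : 1 <= q u by apply: q_ge1; rewrite u1.
    rewrite K_id' ?cell_dim_sphere// /lam max_l; last lra.
    by congr pair; apply/funext => t; rewrite bump_out// to_disc_id ?u1.
  split.
    apply: (@cts_ext _ _ _ (fun p => phid (bump (to_disc p.1) p.2))).
      by move=> p; rewrite KE.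
    apply: (cts_comp cd).
    apply: (cts_comp (f := fun p : 'rV[R]_(dimc c0) * unit_itv R =>
      (to_disc p.1, p.2)) cbump).
    by cts_auto.
  apply: (@cts_ext _ _ _ (fun v => lam (to_disc v))); first by move=> v; rewrite KE.
  by cts_auto.
have KE v : K (phid v) = (fun=> phid (c := c) v, 0).
  have := to_disc_le1 v; rewrite /phid; move: (to_disc v) => u.
  rewrite le_eqVlt => /orP[/eqP u1|u1]; last by rewrite K_id.
  by rewrite K_id'// (leq_trans _ cc0)// cell_dim_sphere.
split.
  apply: (@cts_ext _ _ _ (fun p => phid p.1)); first by move=> p; rewrite KE.
  by cts_auto.
by apply: (@cts_ext _ _ _ (fun=> 0)); [move=> v; rewrite KE|cts_auto].
Qed.

Let K_cts_step c : (dimc c0 < dimc c)%N ->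
  (forall d, (dimc d < dimc c)%N ->
    cts (fun p : 'rV[R]_(dimc d) * unit_itv R => (K (phid p.1)).1 p.2) /\
    cts (fun v : 'rV[R]_(dimc d) => (K (phid v)).2)) ->
  cts (fun p : 'rV[R]_(dimc c) * unit_itv R => (K (phid p.1)).1 p.2) /\
  cts (fun v : 'rV[R]_(dimc c) => (K (phid v)).2).
Proof.
move=> c0c IH; have cd := @cts_char_disc c.
have ct := @cts_to_disc R (dimc c).
have KE v : K (phid v) = step K (to_disc (n := dimc c) v).
  have := to_disc_le1 v; rewrite le_eqVlt => /orP[/eqP|] u1.
    exact: K_sphere_step.
  exact: K_step.
have cK1 := @cts_sphere X (fun p => (K p.1).1 p.2) c (fun d dc => (IH d dc).1).
(* The second component does not involve time; the interval factor is a dummy one. *)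
have cK2 := @cts_sphere R (fun p => (K p.1).2) c _.
have {}cK2 : cts (fun p : set_type (sphere R (dimc c)) * unit_itv R =>
    (K (phi (set_val p.1))).2).
  apply: cK2 => d dc /=; apply: (cts_comp (g := fun v => (K (phid v)).2)).
    exact: (IH d dc).2.
  by cts_auto.
pose r (v : 'rV[R]_(dimc c)) := enorm (to_disc v).
have cr : cts r by apply: cts_comp ct; exact: cts_enorm.
have sphereP (v : 'rV[R]_(dimc c)) : r v != 0 ->
    (r v)^-1 *: to_disc v \in sphere R (dimc c).
  by move=> rv; apply/mem_set/sphereE; exact: enorm_normalize.
split.
  (* Before and after the sphere is reached. On [B] the radius cannot vanish, so the radial
     projection is continuous there. *)
  pose A := [set p : 'rV[R]_(dimc c) * unit_itv R | (1 + 2 * uval p.2) * r p.1 <= 1].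
  pose B := [set p : 'rV[R]_(dimc c) * unit_itv R | 1 <= (1 + 2 * uval p.2) * r p.1].
  have vA := @cts_subset _ A; have vB := @cts_subset _ B.
  apply: (@cts_glue_subset _ _ A B).
  - by apply: closed_le_fun; cts_auto.
  - by apply: closed_le_fun; cts_auto.
  - by move=> p; apply/orP; exact: le_total.
  - apply: (@cts_ext _ _ _ (fun p : set_type A =>
      phid ((1 + 2 * uval (set_val p).2) *: to_disc (set_val p).1))).
      by move=> p; rewrite KE /= ifleT//; exact: (set_valP p).
    apply: (cts_comp cd); apply: cts_scale; first by cts_auto.
    by cts_auto.
  have r0 (p : set_type B) : r (set_val p).1 != 0.
    apply/eqP => rp; have := set_valP p.
    by rewrite /B /= rp mulr0 ler10.
  pose y (p : set_type B) : set_type (sphere R (dimc c)) :=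
    exist (fun w => w \in sphere R (dimc c)) _ (sphereP _ (r0 p)).
  pose t (p : set_type B) := clamp (Num.min (uval (set_val p).2)
    ((1 + 2 * uval (set_val p).2) * r (set_val p).1 - 1)).
  have cy : cts y.
    apply: cts_to_subset; apply: cts_scale; last by cts_auto.
    by apply: cts_inv => //; cts_auto.
  have ctt : cts t by rewrite /t; cts_auto.
  apply: (@cts_ext _ _ _ (fun p => (K (phi (set_val (y p)))).1 (t p))).
    move=> p; rewrite KE /= ifle_ge//; last exact: (set_valP p).
    move=> p1; rewrite /t p1 subrr min_r ?uval_ge0// clamp0 K0.
    rewrite -[_ + _](mulfK (r0 p)) p1 mul1r char_discE//.
    by rewrite (enorm_normalize (r0 p)).
  apply: (cts_comp (f := fun p => (y p, t p)) cK1).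
  by cts_auto.
(* The factor [3 * r - 2] changes sign at [2 / 3]: below, the function is zero; above, the radius is
   bounded away from 0. *)
apply: (@cts_glue_subset _ _ [set v | r v <= 2 / 3] [set v | 2 / 3 <= r v]).
- by apply: closed_le_fun; cts_auto.
- by apply: closed_le_fun; cts_auto.
- by move=> p; apply/orP; exact: le_total.
- apply: (@cts_ext _ _ _ (fun=> 0)); last exact: cts_cst.
  move=> v; have /= vr := set_valP v; rewrite KE /= max_l ?mul0r//.
  by move: vr; rewrite /r; lra.
set B := mkset _; have vB := @cts_subset _ B.
have r0 (v : set_type B) : r (set_val v) != 0.
  by apply/eqP => rv; have := set_valP v; rewrite /B /= rv; lra.
pose y (v : set_type B) : set_type (sphere R (dimc c)) :=
  exist (fun w => w \in sphere R (dimc c)) _ (sphereP _ (r0 v)).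
have cy : cts y.
  apply: cts_to_subset; apply: cts_scale; last by cts_auto.
  by apply: cts_inv => //; cts_auto.
apply: (@cts_ext _ _ _ (fun v => Num.max 0 (3 * r (set_val v) - 2) *
    (K (phi (set_val (y v)))).2)).
  by move=> v; rewrite KE.
apply: cts_mul; first by cts_auto.
apply: (cts_comp (f := fun v => (y v, itv0)) cK2).
by cts_auto.
Qed.

Let K_cts c :
  cts (fun p : 'rV[R]_(dimc c) * unit_itv R => (K (phid p.1)).1 p.2) /\
  cts (fun v : 'rV[R]_(dimc c) => (K (phid v)).2).
Proof.
move: {2}(dimc c) (leqnn (dimc c)) => k; elim: k c => [|k IHk] c ck.
  by apply: K_cts_base; rewrite (leq_trans ck).
have [cc0|c0c] := leqP (dimc c) (dimc c0); first exact: K_cts_base.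
by apply: K_cts_step => // d dc; apply: IHk; rewrite -ltnS (leq_trans dc).
Qed.

Lemma cw_deformation : exists (H : X * unit_itv R -> X) (l : X -> unit_itv R),
  [/\ cts H, cts l,
    (forall x, H (x, itv0) = x) /\ (forall t, H (phi v0, t) = phi v0),
    l (phi v0) = itv1 &
    forall x, 0 < uval (l x) -> H (x, itv1) = phi v0].
Proof.
exists (fun p => (K p.1).1 p.2), (fun x => clamp (K x).2); split=> //=.
- by apply: (cts_final_itv char_disc_final) => c; have [] := K_cts c.
- apply: (cts_final char_disc_final) => c; have [_ cK] := K_cts c.
  by cts_auto.
- by rewrite K_lam clamp1.
move=> x; have [l0|l0 _] := leP (K x).2 0; first by rewrite clamp_le0// uval0 ltxx.
exact: K1.
Qed.

End cw_well_pointed.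

(** The basepoint lies in an open cell of some dimension; a small ball around it there starts the
    induction. *)
Lemma pcCW_well_pointed (R : realType) (X : pcCW R) : well_pointed R X.
Proof.
have [hX [S]] := pcCW_cw X.
split; first exact/accessible_closed_set1/hausdorff_accessible.
have := cell_ofK S point; have := cell_of1 S (point : X).
case: (cell_of S point) => c v /= v1 vp.
have : nbhs v (open_disc R (Defs.dim c)).
  apply: open_nbhs_nbhs; split; [exact: open_open_disc|exact/open_discE].
move=> /nbhs_normP[eps /= eps0 veps].
have v0eps w : `|w - v| < eps -> enorm w < 1.
  by move=> wv; apply/open_discE/veps; rewrite /= distrC.
by rewrite -vp; exact: cw_deformation eps0 v0eps.
Qed.

(** [m v ~ v' w' m v = v' n w v ~ v' n]. Strictly natural equivalences thus have inverses natural up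
    to homotopy, whichever inverses are taken. *)
Lemma inverse_natural (R : realType) (X Y X' Y' : ptopologicalType)
    (w : X -> Y) (v : Y -> X) (w' : X' -> Y') (v' : Y' -> X')
    (m : X -> X') (n : Y -> Y') :
  pointed_map w -> pointed_map v -> pointed_map v' ->
  pointed_map m -> pointed_map n ->
  pointed_homotopic R (v' \o w') idfun -> pointed_homotopic R (w \o v) idfun ->
  w' \o m = n \o w -> pointed_homotopic R (m \o v) (v' \o n).
Proof.
move=> pw pv pv' pm pn vw' wv wm.
have pmv := pm_comp pv pm; have pvn := pm_comp pn pv'.
apply: (@ph_trans _ _ _ _ ((v' \o w') \o (m \o v))).
  apply: ph_sym; rewrite -[X in pointed_homotopic _ _ X]/(idfun \o (m \o v)).
  by apply: ph_comp => //; [exact: pm_id|exact: ph_refl].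
rewrite (_ : _ \o _ = (v' \o n) \o (w \o v)); last first.
  by rewrite -[LHS]/((v' \o (w' \o m)) \o v) wm.
rewrite -[X in pointed_homotopic _ _ X]/((v' \o n) \o idfun).
by apply: ph_comp => //; [exact: pm_comp|exact: ph_refl].
Qed.

(** * Naturality *)

Section functoriality.
Variable R : realType.

Definition uh_map (X Y Z X' Y' Z' : ptopologicalType)
    (g : X -> Y) (h : X -> Z) (g' : X' -> Y') (h' : X' -> Z')
    (u : X -> X') (v : Y -> Y') (w : Z -> Z') : uh R g h -> uh R g' h' :=
  uh_rec (fun y => uY g' h' (v y)) (fun q => uX g' h' (u q.1, q.2))
    (fun z => uZ g' h' (w z)).

Section uh_map.
Variables (X Y Z X' Y' Z' : ptopologicalType).
Variables (g : X -> Y) (h : X -> Z) (g' : X' -> Y') (h' : X' -> Z').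
Variables (u : X -> X') (v : Y -> Y') (w : Z -> Z').
Hypotheses (vg : forall x, v (g x) = g' (u x)).
Hypotheses (wh : forall x, w (h x) = h' (u x)).

Let map0 x : uX g' h' (u x, @itv0 R) = uY g' h' (v (g x)).
Proof. by rewrite uX0 vg. Qed.

Let map1 x : uX g' h' (u x, @itv1 R) = uZ g' h' (w (h x)).
Proof. by rewrite uX1 wh. Qed.

Lemma uh_mapY y :
  uh_map (g := g) (h := h) g' h' u v w (uY g h y) = uY g' h' (v y).
Proof. exact: uh_recY. Qed.

Lemma uh_mapX x t :
  uh_map (g := g) (h := h) g' h' u v w (uX g h (x, t)) = uX g' h' (u x, t).
Proof. exact: uh_recX. Qed.

Lemma uh_mapZ z :
  uh_map (g := g) (h := h) g' h' u v w (uZ g h z) = uZ g' h' (w z).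
Proof. exact: uh_recZ. Qed.

Lemma uh_map_pm : cts u -> cts w -> pointed_map v ->
  pointed_map (uh_map (g := g) (h := h) g' h' u v w).
Proof.
move=> cu cw [cv v0]; have {}cv : cts v by [].
split; last by rewrite -[LHS]/(uh_map _ _ u v w (uY g h point)) uh_mapY v0.
by apply: cts_uh_rec => //; cts_auto.
Qed.

End uh_map.

(** * The zigzag of a tuple *)

Section comparison.
Variable T : null_tuple R.

Definition tuple_split := split_wedge R (tA T) (tB T) (tC T).

Definition tuple_end (p : tA T * tB T) : (tC T * tB T)%type := (tf p.1, p.2).

Definition tuple_homotopy (q : tA T * tB T * unit_itv R) : (tC T * tB T)%type :=
  (tH (q.1.1, q.2), q.1.2).

Definition collapse : tuple_split -> tuple_wedge T :=
  pwedge2_map (@to_join R (tA T) (tB T)) (@to_half_smash R (tC T) (tB T)).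

Definition comparison : tuple_split -> tuple_pushout T :=
  @to_hpushout R _ _ _ (@fst (tA T) (tB T)) tuple_end
  \o attach (@fst (tA T) (tB T)) tuple_end (@const_end _ _ _) tuple_homotopy
  \o @split R (tA T) (tB T) (tC T).

Lemma collapse_tuple_he : pointed_homotopy_equivalence R collapse.
Proof.
apply: pwedge2_map_he.
  by apply: to_join_he; exact: pcCW_well_pointed.
by apply: to_half_smash_he; exact: pcCW_well_pointed.
Qed.

Lemma comparison_he : pointed_homotopy_equivalence R comparison.
Proof.
have [cf f0] := tf_pointed T; have {}cf : cts (@tf R T) by [].
have cH : cts (@tH R T) by exact: tH_continuous.
apply: (@he_comp R _ (uh R (@fst (tA T) (tB T)) tuple_end)).
  apply: (@he_comp R _ (const_pushout R (tA T) (tB T) (tC T))).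
    exact: split_he.
  apply: attach_he.
  - by rewrite /tuple_homotopy; cts_auto.
  - by move=> [x y]; rewrite /tuple_homotopy /= tH0.
  - by move=> [x y]; rewrite /tuple_homotopy /= tH1.
apply: to_hpushout_he => //.
- by rewrite /tuple_end; cts_auto.
- by rewrite /tuple_end /= f0.
- by apply: well_pointed_prod; exact: pcCW_well_pointed.
- by apply: well_pointed_prod; exact: pcCW_well_pointed.
Qed.

End comparison.

Arguments collapse : clear implicits.
Arguments comparison : clear implicits.

(** * Strict naturality of the zigzag *)

Section naturality.
Variables (T T' : null_tuple R).
Variables (a : tA T -> tA T') (b : tB T -> tB T') (c : tC T -> tC T').
Hypotheses (pa : pointed_map a) (pb : pointed_map b) (pc : pointed_map c).
Hypothesis cH : forall x (t : unit_itv R), c (tH (x, t)) = tH (a x, t).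

Let ab (p : tA T * tB T) : (tA T' * tB T')%type := (a p.1, b p.2).
Let cb (p : tC T * tB T) : (tC T' * tB T')%type := (c p.1, b p.2).

Definition ujoin_map : ujoin R (tA T) (tB T) -> ujoin R (tA T') (tB T') :=
  uh_map (@fst _ _) (@snd _ _) ab a b.

Definition coned_map : coned R (tC T) (tB T) -> coned R (tC T') (tB T') :=
  uh_map (@cone_vertex _) (@cone_base _ _) b idfun cb.

Definition tuple_split_map : tuple_split T -> tuple_split T' :=
  pwedge2_map ujoin_map coned_map.

Let cone_base_nat y : cb (cone_base (tC T) y) = cone_base (tC T') (b y).
Proof. by rewrite /cb /cone_base /= pc.2. Qed.

Let ca : cts a. Proof. by case: pa. Qed.
Let cb' : cts b. Proof. by case: pb. Qed.
Let cc : cts c. Proof. by case: pc. Qed.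

Lemma ujoin_map_pm : pointed_map ujoin_map.
Proof. by apply: uh_map_pm => //; rewrite /ab; cts_auto. Qed.

Lemma coned_map_pm : pointed_map coned_map.
Proof.
by apply: uh_map_pm => //; [rewrite /cb; cts_auto|exact: pm_id].
Qed.

Lemma tuple_split_map_pm : pointed_map tuple_split_map.
Proof.
by apply: pwedge2_map_pm; [exact: ujoin_map_pm|exact: coned_map_pm].
Qed.

Lemma tuple_split_map_wl w :
  tuple_split_map (wl _ w) = wl _ (ujoin_map w).
Proof. by rewrite /tuple_split_map pwedge2_map_wl//;
  [have [] := ujoin_map_pm|have [] := coned_map_pm]. Qed.

Lemma tuple_split_map_wr w :
  tuple_split_map (wr _ w) = wr _ (coned_map w).
Proof. by rewrite /tuple_split_map pwedge2_map_wr//;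
  [have [] := ujoin_map_pm|have [] := coned_map_pm]. Qed.

Lemma to_join_nat w : to_join (ujoin_map w) = join_map a b (to_join w).
Proof.
have [_ a0] := pa; have [_ b0] := pb.
elim/uh_ind: w => [x|[[x y] t]|y]; rewrite /ujoin_map.
- by rewrite uh_mapY// !to_joinY join_mapE// b0.
- by rewrite uh_mapX// !to_joinX join_mapE.
- by rewrite uh_mapZ// !to_joinZ join_mapE// a0.
Qed.

Lemma to_half_smash_nat w :
  to_half_smash (coned_map w) = half_smash_map c b (to_half_smash w).
Proof.
have [_ b0] := pb; have [_ c0] := pc.
have E : half_smash_map c b point = point.
  by rewrite half_smash_mapE// c0 b0.
elim/uh_ind: w => [x|[y t]|[z y]]; rewrite /coned_map.
- by rewrite uh_mapY// !to_half_smashY E.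
- by rewrite uh_mapX// !to_half_smashX E.
- by rewrite uh_mapZ// !to_half_smashZ half_smash_mapE.
Qed.

Lemma tuple_wedge_map_pm : pointed_map (@tuple_wedge_map R T T' a b c).
Proof.
have [_ a0] := pa; have [_ b0] := pb; have [_ c0] := pc.
apply: pwedge2_map_pm; split.
- apply: cts_quot.
  apply: (@cts_ext _ _ _ (fun p => quot_pi (@join_rel R _ _) (a p.1.1, p.1.2, b p.2))).
    by move=> [[x t] y]; rewrite join_mapE.
  by cts_auto.
- by rewrite join_mapE// a0 b0.
- apply: cts_quot.
  apply: (@cts_ext _ _ _ (fun p => quot_pi (@half_smash_rel _ _) (c p.1, b p.2))).
    by move=> [x y]; rewrite half_smash_mapE.
  by cts_auto.
- by rewrite half_smash_mapE// c0 b0.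
Qed.

Lemma collapse_nat :
  collapse T' \o tuple_split_map = tuple_wedge_map a b c \o collapse T.
Proof.
have jp (U : null_tuple R) : @to_join R (tA U) (tB U) point = point.
  by have [[_ ->]] := to_join_he (pcCW_well_pointed (tA U)) (pcCW_well_pointed (tB U)).
have sp (U : null_tuple R) : @to_half_smash R (tC U) (tB U) point = point.
  by have [[_ ->]] := to_half_smash_he (tB U) (pcCW_well_pointed (tC U)).
have jm : join_map a b point = point :> reduced_join R _ _.
  by rewrite -jp -to_join_nat; have [_ ->] := ujoin_map_pm.
have sm : half_smash_map c b point = point.
  by rewrite -sp -to_half_smash_nat; have [_ ->] := coned_map_pm.
apply/funext; apply: pwedge2_ind => w /=.
  rewrite tuple_split_map_wl /collapse !pwedge2_map_wl ?jp ?sp//.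
  by rewrite /tuple_wedge_map pwedge2_map_wl// to_join_nat.
rewrite tuple_split_map_wr /collapse !pwedge2_map_wr ?jp ?sp//.
by rewrite /tuple_wedge_map pwedge2_map_wr// to_half_smash_nat.
Qed.

(** The appended homotopy is the only ingredient that depends on more than the three spaces and [f];
    as its square commutes strictly, so does the comparison. *)
Lemma comparison_nat :
  comparison T' \o tuple_split_map = tuple_pushout_map a b c \o comparison T.
Proof.
have [_ a0] := pa; have [_ b0] := pb; have [_ c0] := pc.
have H1 (U : null_tuple R) p : @tuple_homotopy U (p, itv1) = const_end (tC U) p.
  by case: p => x y; rewrite /tuple_homotopy /= tH1.
have aY (U : null_tuple R) := attachY (@fst (tA U) (tB U)) (@tuple_end U) (@H1 U).
have aX (U : null_tuple R) := attachX (@fst (tA U) (tB U)) (@tuple_end U) (@H1 U).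
have aZ (U : null_tuple R) := attachZ (@fst (tA U) (tB U)) (@tuple_end U) (@H1 U).
(* The square of homotopies at time 0 is the compatibility of [c] and [a] with the maps [f]. *)
have endE : cb \o @tuple_end T = @tuple_end T' \o ab.
  apply/funext => -[x y]; rewrite /cb /tuple_end /=.
  by rewrite -(@tH0 R T) cH tH0.
have ab0 : ab point = point by rewrite /ab /= a0 b0.
have mapE p : tuple_pushout_map a b c (to_hpushout (quot_pi _ p)) =
    to_hpushout (quot_pi (uh_rel (@fst _ _) (@tuple_end T'))
      (cylinder_map ab a cb p)).
  by rewrite !to_hpushoutE /tuple_pushout_map hpushout_mapE.
have mapY x : tuple_pushout_map a b c (to_hpushout (uY _ _ x)) =
    to_hpushout (uY (@fst _ _) (@tuple_end T') (a x)) by exact: mapE.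
have mapX p t : tuple_pushout_map a b c (to_hpushout (uX _ _ (p, t))) =
    to_hpushout (uX (@fst _ _) (@tuple_end T') (ab p, t)) by exact: mapE.
have mapZ z : tuple_pushout_map a b c (to_hpushout (uZ _ _ z)) =
    to_hpushout (uZ (@fst _ _) (@tuple_end T') (cb z)) by exact: mapE.
have HE p t : cb (tuple_homotopy (p, t)) = tuple_homotopy (ab p, t).
  by rewrite /cb /tuple_homotopy /= cH.
have nX p t :
    to_hpushout (attach fst (@tuple_end T') (@const_end _ _ _)
      (@tuple_homotopy T') (uX fst (@const_end _ _ _) (ab p, t))) =
    tuple_pushout_map a b c (to_hpushout (attach fst (@tuple_end T)
      (@const_end _ _ _) (@tuple_homotopy T) (uX fst (@const_end _ _ _) (p, t)))).
  by rewrite !aX /ifle; case: ifP => _; rewrite ?mapX ?mapZ ?HE.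
apply/funext; apply: pwedge2_ind; apply: uh_ind => [x|[p t]|z] /=.
- rewrite tuple_split_map_wl /ujoin_map uh_mapY// /comparison /=.
  by rewrite !split_wlY !aY mapY.
- rewrite tuple_split_map_wl /ujoin_map uh_mapX// /comparison /=.
  by rewrite !split_wlX nX.
- rewrite tuple_split_map_wl /ujoin_map uh_mapZ// /comparison /=.
  by rewrite !split_wlZ !aZ mapZ /cb /= c0.
- rewrite tuple_split_map_wr /coned_map uh_mapY// /comparison /=.
  by rewrite !split_wrY !aY mapY a0.
- rewrite tuple_split_map_wr /coned_map uh_mapX// /comparison /=.
  by rewrite !split_wrX -nX /ab /= a0.
- rewrite tuple_split_map_wr /coned_map uh_mapZ// /comparison /=.
  by rewrite !split_wrZ !aZ mapZ.
Qed.

End naturality.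
End functoriality.

Arguments collapse {R} T _.
Arguments comparison {R} T _.

Theorem lemma2p5 (R : realType) :
  exists e : forall T : null_tuple R, tuple_wedge T -> tuple_pushout T,
    (forall T : null_tuple R, pointed_homotopy_equivalence R (e T)) /\
    (forall (T T' : null_tuple R)
       (a : tA T -> tA T') (b : tB T -> tB T') (c : tC T -> tC T'),
       pointed_map a -> pointed_map b -> pointed_map c ->
       (forall (x : tA T) (t : unit_itv R), c (tH (x, t)) = tH (a x, t)) ->
       pointed_homotopic R
         (tuple_pushout_map a b c \o e T)
         (e T' \o tuple_wedge_map a b c)).
Proof.
(* The inverses are chosen tuple by tuple, with no regard to maps between tuples; [inverse_natural]
   accepts any choice. *)
pose v (T : null_tuple R) := projT1 (cid (collapse_tuple_he T).2).
have vP T : [/\ pointed_map (v T), pointed_homotopic R (v T \o collapse T) idfun &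
    pointed_homotopic R (collapse T \o v T) idfun].
  exact: (projT2 (cid (collapse_tuple_he T).2)).
exists (fun T => comparison T \o v T); split=> [T|T T' a b c pa pb pc cH].
  have [pv vw wv] := vP T; apply: he_comp; last exact: comparison_he.
  by apply: he_inv pv vw wv; exact: (collapse_tuple_he T).1.
have [pv vw wv] := vP T; have [pv' vw' wv'] := vP T'.
have pM := tuple_split_map_pm pa pb pc; have pW := tuple_wedge_map_pm pa pb pc.
have pF := (comparison_he T').1.
change (pointed_homotopic R ((tuple_pushout_map a b c \o comparison T) \o v T)
  (comparison T' \o (v T' \o tuple_wedge_map a b c))).
rewrite -(comparison_nat pa pb pc cH).
have key := inverse_natural (collapse_tuple_he T).1 pv pv' pM pW vw' wv
  (collapse_nat pa pb pc).
exact: (ph_comp (pm_comp pv pM) pF key (ph_refl R pF)).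
Qed.
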